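(* Let $d\ge 2$ and let $\{e_i\}_{i\ge1}$ be the nearest-neighbour edges of $\mathbb{Z}^d$. Let $\{t(e_i)\}_{i\ge1}$ be independent (not necessarily identically distributed) nonnegative real random variables such that (i) $\sup_i \mathbb{P}(t(e_i)<\epsilon)\to 0$ as $\epsilon\downarrow 0$; (ii) there exists a constant $\eta>0$ with $\sup_i \mathbb{E}\left[t(e_i)^{6(1+d)+\eta}\right]<\infty$. For $n\ge1$ let $T(0,n)$ be the minimum passage time from the origin to $(n,\mathbf{0})$. Then $$\frac1n\bigl(T(0,n)-\mathbb{E}T(0,n)\bigr)\longrightarrow 0\quad\text{almost surely and in }L^2$$ as $n\to\infty$.
   Context: $\mathbf{0}$ denotes the $(d-1)$-dimensional zero vector, so $(n,\mathbf{0})\in\mathbb{Z}^d$ and the origin is $(0,\mathbf{0})$. For a finite nearest-neighbour path $\pi$ in $\mathbb{Z}^d$ with (distinct) edges $h_1,\dots,h_k$, its passage time is $T(\pi)=\sum_{j=1}^k t(h_j)$. $T(0,n)$ is the shortest passage time of a path from $(0,\mathbf{0})$ to $(n,\mathbf{0})$, i.e. the infimum of $T(\pi)$ over all finite paths $\pi$ from $(0,\mathbf{0})$ to $(n,\mathbf{0})$ (under the hypotheses this infimum is almost surely attained). *)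

(* Defs.v *)
From HB Require Import structures.
From mathcomp Require Import all_boot all_order all_algebra finmap.
From mathcomp Require Import all_classical all_reals all_analysis.

Set Implicit Arguments.
Unset Strict Implicit.
Unset Printing Implicit Defensive.

Import Order.TTheory GRing.Theory Num.Theory.
Import numFieldNormedType.Exports.

Local Open Scope classical_set_scope.
Local Open Scope fset_scope.
Local Open Scope ring_scope.

Definition neighbours (d : nat) (x y : 'rV[int]_d) : bool :=
  \sum_(i < d) `|x ord0 i - y ord0 i| == 1.

(* Edges are unoriented: an edge is the two-element set of its endpoints. *)
Definition is_edge (d : nat) (A : {fset 'rV[int]_d}) : bool :=
  `[< exists x y, neighbours x y /\ A = [fset x; y] >].

Definition edge (d : nat) := {A : {fset 'rV[int]_d} | is_edge A}.

(* The edges hs, traversed in this order, lead from x to y. *)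
Fixpoint joins (d : nat) (x : 'rV[int]_d) (hs : seq (edge d)) (y : 'rV[int]_d)
    : Prop :=
  if hs is h :: hs' then
    exists z, val h = [fset x; z] /\ joins z hs' y
  else x = y.

Definition is_path (d : nat) (x y : 'rV[int]_d) (hs : seq (edge d)) : Prop :=
  joins x hs y /\ uniq hs.

Definition axis_point (d n : nat) : 'rV[int]_d :=
  \row_(i < d) (if i == 0%N :> nat then n%:Z else 0).

Section Passage.
Context (R : realType) (d : nat).
Implicit Type t : edge d -> R.

Definition path_time t (hs : seq (edge d)) : R := \sum_(h <- hs) t h.

(* A genuine infimum when t >= 0: the set is then bounded below by 0, and it is
   nonempty for 0 < d. *)
Definition passage_time t (n : nat) : R :=
  inf [set path_time t hs | hs in is_path (0 : 'rV[int]_d) (axis_point d n)].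

End Passage.

Section Probability.
Context (disp : measure_display) (T : measurableType disp) (R : realType).
Variable P : probability T R.

Definition mutually_independent (I : choiceType) (X : I -> {RV P >-> R})
    : Prop :=
  forall (J : {fset I}) (B : I -> set R),
    (forall i, i \in J -> measurable (B i)) ->
    P (\bigcap_(i in [set i | i \in J]) (X i @^-1` B i)) =
      (\prod_(i <- J) P (X i @^-1` B i))%E.

Definition cvg_almost_surely (X : nat -> T -> R) (Y : T -> R) : Prop :=
  {ae P, forall w, X n w @[n --> \oo] --> Y w}.

Definition cvg_in_L2 (X : nat -> T -> R) (Y : T -> R) : Prop :=
  [/\ forall n, X n \in Lfun P 2%:E, Y \in Lfun P 2%:E &
      ('N[P]_2%:E[(fun w => (X n w - Y w)%:E)])%E @[n --> \oo] --> 0%E].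

End Probability.

(* Main.v *)
Require Import Defs.
From HB Require Import structures.
From mathcomp Require Import all_boot all_order all_algebra finmap.
From mathcomp Require Import all_classical all_reals all_analysis.
From mathcomp Require Import measurable_realfun.
From mathcomp Require Import ring lra zify.

Set Implicit Arguments.
Unset Strict Implicit.
Unset Printing Implicit Defensive.

Import Order.TTheory GRing.Theory Num.Theory.
Import numFieldNormedType.Exports.

Local Open Scope classical_set_scope.
Local Open Scope ring_scope.

(** The passage time [T n] is shown to have a variance that is small compared
    to [n ^ 2], by a summable factor along the integers [n = k ^ 4];
    consecutive values [k ^ 4] are close enough for interpolation.

    Variance. By the Efron-Stein inequality the variance of a function of
    independent variables is at most the expected sum, over the variables, of
    the squared increase caused by resampling that variable. Resampling the
    time of an edge increases a minimum of path times only if the edge lies on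
    the minimizing path, and then at most by its new time. If all paths have
    at most [M] edges, the variance of their minimum is therefore at most [M]
    times a bound on the second moments ([variance_min_sum],
    [min_time_variance]). Efron-Stein is proved on finite product spaces by
    finite sums; the edge times are first rounded to a finite grid, at a cost
    that is bounded in mean square.

    Restriction to paths of at most [2 m] edges. If it changes the passage
    time, some trail of [2 m] distinct edges from the origin is not slower
    than the straight path, whose time [S] has a fourth moment of order
    [n ^ 4]. Since edge times below some [eps] are unlikely, a union bound
    over the trails and over the sets of fast edges shows that a trail of time
    less than [eps * m] exists with probability at most [2 ^ (- m)]
    ([expect_cheap]). So the change is small in mean square when [m] is much
    larger than [n] ([truncation_error]).

    Conclusion. With [n = k ^ 4] and [m = k ^ 6], the passage time is
    within order [k ^ 3] of a constant in mean square ([block_variance]).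
    Erasing loops from a path prolonged along the axis shows that passage
    times to two points of the axis differ at most by the time of the segment
    between them, so the same order [k ^ 3] holds for all [n] from [k ^ 4]
    to [(k + 1) ^ 4]. Thus the squares of the normalized deviations are
    dominated, on the block [k], by a function of expectation of order
    [1 / k ^ 2]: these expectations tend to 0, which gives the convergence
    in mean square, and they are summable, which gives the almost sure
    convergence ([block_cvg_ae], [block_cvg_L2]). *)

(** * Variance on a finite product space *)

Section ProductSpace.
Context (R : realFieldType) (I V : finType) (p : I -> V -> R).
Hypothesis p_ge0 : forall i a, 0 <= p i a.
Hypothesis p_sum1 : forall i, \sum_a p i a = 1.
Local Notation state := {ffun I -> V}.
Implicit Types (f g : state -> R) (v : state) (i j : I) (a b : V).

Definition weight v : R := \prod_i p i (v i).
Definition mean f : R := \sum_v weight v * f v.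
Definition upd v i a : state := [ffun j => if j == i then a else v j].
(** The conditional expectation given all coordinates but [i]. *)
Definition avg i f : state -> R := fun v => \sum_a p i a * f (upd v i a).

Lemma weight_ge0 v : 0 <= weight v.
Proof. by apply: prodr_ge0 => i _. Qed.

Lemma weight_sum1 : \sum_v weight v = 1.
Proof.
rewrite -(bigA_distr_bigA (fun i a => p i a)) big1// => i _; exact: p_sum1.
Qed.

Lemma upd_id v i : upd v i (v i) = v.
Proof. by apply/ffunP => j; rewrite ffunE; case: eqP => [->|]. Qed.

Lemma upd_upd v i a b : upd (upd v i a) i b = upd v i b.
Proof. by apply/ffunP => j; rewrite !ffunE; case: eqP. Qed.

Lemma updE v i a : upd v i a i = a. Proof. by rewrite ffunE eqxx. Qed.

Lemma updC v i j a b : i != j -> upd (upd v i a) j b = upd (upd v j b) i a.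
Proof.
move=> ij; apply/ffunP => k; rewrite !ffunE.
by case: (k =P j) => [->|//]; rewrite eq_sym (negPf ij).
Qed.

Lemma weight_upd v i a : weight (upd v i a) * p i (v i) = weight v * p i a.
Proof.
rewrite /weight (bigD1 i)//= [in RHS](bigD1 i)//= updE.
rewrite (eq_bigr (fun j => p j (v j))); first by ring.
by move=> j ji; rewrite ffunE (negPf ji).
Qed.

(** The old and the new value of a resampled coordinate are exchangeable:
    swapping them is an involution on pairs that preserves the joint weight. *)
Lemma resample_swap i (G : state -> state -> R) :
  \sum_v \sum_a weight v * p i a * G v (upd v i a) =
  \sum_v \sum_a weight v * p i a * G (upd v i a) v.
Proof.
rewrite !pair_big /=.
pose h (x : state * V) := (upd x.1 i x.2, x.1 i).
have hK : involutive h by case=> v a; rewrite /h /= updE upd_upd upd_id.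
rewrite (reindex_inj (inv_inj hK)) /=; apply: eq_bigr => -[v a] _ /=.
by rewrite weight_upd upd_upd upd_id.
Qed.

Lemma mean_avgE i f g :
  mean (fun v => f v * avg i g v) =
  \sum_v \sum_a weight v * p i a * (f v * g (upd v i a)).
Proof.
apply: eq_bigr => v _; rewrite /avg !mulr_sumr; apply: eq_bigr => a _; ring.
Qed.

Lemma sum_const f i :
  \sum_v \sum_a weight v * p i a * f v = mean f.
Proof.
apply: eq_bigr => v _; under eq_bigr do rewrite mulrAC.
by rewrite -mulr_sumr p_sum1 mulr1.
Qed.

Lemma mean_avg i f : mean (avg i f) = mean f.
Proof.
rewrite -(sum_const f i) (resample_swap i (fun v _ => f v)).
by apply: eq_bigr => v _; rewrite mulr_sumr; apply: eq_bigr => a _;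
  rewrite mulrA.
Qed.

(** With [avg_idem], this makes [avg i] an orthogonal projection of the space
    of functions with scalar product [mean (f * g)]. *)
Lemma avg_selfadj i f g :
  mean (fun v => f v * avg i g v) = mean (fun v => avg i f v * g v).
Proof.
rewrite mean_avgE (resample_swap i (fun v v' => f v * g v')).
apply: eq_bigr => v _; rewrite /avg mulr_suml mulr_sumr.
by apply: eq_bigr => a _; ring.
Qed.

Lemma avg_indep i f v a : avg i f (upd v i a) = avg i f v.
Proof. by apply: eq_bigr => b _; rewrite upd_upd. Qed.

Lemma avg_idem i f v : avg i (avg i f) v = avg i f v.
Proof.
rewrite [LHS]/avg; under eq_bigr do rewrite avg_indep.
by rewrite -mulr_suml p_sum1 mul1r.
Qed.

Lemma avgC i j f v : avg i (avg j f) v = avg j (avg i f) v.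
Proof.
have [->//|ij] := eqVneq i j.
rewrite /avg; under eq_bigr do rewrite mulr_sumr.
under [RHS]eq_bigr do rewrite mulr_sumr.
rewrite exchange_big; apply: eq_bigr => a _; apply: eq_bigr => b _.
by rewrite updC// mulrCA.
Qed.

Lemma eq_avg i f g : f =1 g -> avg i f =1 avg i g.
Proof. by move=> fg v; apply: eq_bigr => a _; rewrite fg. Qed.

Lemma eq_mean f g : f =1 g -> mean f = mean g.
Proof. by move=> fg; apply: eq_bigr => v _; rewrite fg. Qed.

Lemma avgB i f g v : avg i (fun v => f v - g v) v = avg i f v - avg i g v.
Proof. by rewrite /avg -sumrB; apply: eq_bigr => a _; rewrite mulrBr. Qed.

Lemma meanB f g : mean (fun v => f v - g v) = mean f - mean g.
Proof. by rewrite /mean -sumrB; apply: eq_bigr => a _; rewrite mulrBr. Qed.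

Lemma ler_mean f g : (forall v, f v <= g v) -> mean f <= mean g.
Proof. by move=> fg; apply: ler_sum => v _; rewrite ler_wpM2l ?weight_ge0. Qed.

Lemma avg_pythagoras i f :
  mean (fun v => (f v - avg i f v) ^+ 2) =
  mean (fun v => f v ^+ 2) - mean (fun v => avg i f v ^+ 2).
Proof.
have -> : mean (fun v => (f v - avg i f v) ^+ 2) = mean (fun v =>
    (f v ^+ 2 - avg i f v ^+ 2)
    - (f v * avg i f v - avg i f v * avg i f v)
    - (f v * avg i f v - avg i f v * avg i f v)).
  by apply: eq_mean => v; ring.
rewrite !meanB avg_selfadj.
have E : mean (fun v => avg i f v * f v) = mean (fun v =>
  avg i f v * avg i f v).
  rewrite -avg_selfadj -[RHS]avg_selfadj.
  by apply: eq_mean => v; rewrite avg_idem.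
by rewrite E subrr !subr0.
Qed.

Lemma mean_sqr_ge0 f : 0 <= mean (fun v => f v ^+ 2).
Proof. by apply: sumr_ge0 => v _; rewrite mulr_ge0 ?sqr_ge0 ?weight_ge0. Qed.

Lemma mean_avg_sqr i f :
  mean (fun v => avg i f v ^+ 2) <= mean (fun v => f v ^+ 2).
Proof. by rewrite -subr_ge0 -avg_pythagoras mean_sqr_ge0. Qed.

Definition avgs (s : seq I) f := foldr avg f s.

Lemma avgsB s f g v : avgs s (fun v => f v - g v) v = avgs s f v - avgs s g v.
Proof.
elim: s v => //= i s IH v; rewrite -avgB; exact: eq_avg.
Qed.

Lemma avgsC i s f v : avg i (avgs s f) v = avgs s (avg i f) v.
Proof.
elim: s v => //= j s IH v; rewrite avgC; exact: eq_avg.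
Qed.

Lemma mean_avgs s f : mean (avgs s f) = mean f.
Proof. by elim: s => //= i s IH; rewrite mean_avg. Qed.

Lemma mean_avgs_sqr s f :
  mean (fun v => avgs s f v ^+ 2) <= mean (fun v => f v ^+ 2).
Proof. by elim: s => //= i s; apply: le_trans; exact: mean_avg_sqr. Qed.

(** By Pythagoras, averaging [g := avgs s f] over one more coordinate [i] loses
    the squared norm of [g - avg i g]. Averages commute, so this function is
    [avgs s (f - avg i f)], and averages are contractions. *)
Lemma avgs_sqr_loss s f :
  mean (fun v => f v ^+ 2) - mean (fun v => avgs s f v ^+ 2) <=
  \sum_(i <- s) mean (fun v => (f v - avg i f v) ^+ 2).
Proof.
elim: s => [|i s IH]; first by rewrite big_nil /= subrr.
rewrite big_cons /= [leRHS]addrC.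
set b := mean (fun v => avgs s f v ^+ 2) in IH *.
rewrite -[leLHS](subrKA b).
apply: lerD IH _.
rewrite /b /= -avg_pythagoras (@eq_mean _ (fun v => avgs s (fun v =>
  f v - avg i f v) v ^+ 2)).
  exact: mean_avgs_sqr.
by move=> v; rewrite avgsC avgsB.
Qed.

Lemma avgs_indep s f i v a : i \in s -> avgs s f (upd v i a) = avgs s f v.
Proof.
elim: s v => //= j s IH v; rewrite inE => /orP[/eqP->|/IH {}IH].
  exact: avg_indep.
have [->|ij] := eqVneq i j; first exact: avg_indep.
by apply: eq_bigr => b _; rewrite updC// IH.
Qed.

(** A function that no single update changes is constant: any state is reached
    from any other by updating the coordinates one after the other. *)
Lemma avgs_enum f v v' : avgs (enum I) f v = avgs (enum I) f v'.
Proof.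
set g := avgs _ _.
have gE : forall s : seq I, g v = g [ffun i => if i \in s then v' i else v i].
  elim=> [|i s ->]; first by congr g; apply/ffunP => i; rewrite ffunE.
  rewrite -[LHS](@avgs_indep (enum I) f i _ (v' i)) ?mem_enum//; congr g.
  by apply/ffunP => j; rewrite !ffunE inE; case: eqP => [->|].
rewrite (gE (enum I)); congr g; apply/ffunP => i.
by rewrite ffunE mem_enum.
Qed.

Lemma avgs_enumE f v : avgs (enum I) f v = mean f.
Proof.
rewrite -(mean_avgs (enum I)) /mean.
under eq_bigr do rewrite (avgs_enum f _ v).
by rewrite -mulr_suml weight_sum1 mul1r.
Qed.

Lemma variance_tensorization f :
  mean (fun v => (f v - mean f) ^+ 2) <=
  \sum_i mean (fun v => (f v - avg i f v) ^+ 2).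
Proof.
have -> : mean (fun v => (f v - mean f) ^+ 2) =
    mean (fun v => f v ^+ 2) - mean (fun v => avgs (enum I) f v ^+ 2).
  have E (w : R) : mean (fun=> w) = w.
    by rewrite /mean -mulr_suml weight_sum1 mul1r.
  rewrite [X in _ - X](@eq_mean _ (fun=> mean f ^+ 2)); last first.
    by move=> v; rewrite avgs_enumE.
  rewrite E (@eq_mean _ (fun v => (f v ^+ 2 - (mean f *
    f v - mean f ^+ 2)) - mean f * f v)).
    have F : mean (fun v => mean f * f v) = mean f ^+ 2.
      rewrite expr2 [X in _ = _ * X]/mean mulr_sumr; apply: eq_bigr => v _;
        ring.
    by rewrite !meanB F E; ring.
  by move=> v; ring.
by apply: (le_trans (avgs_sqr_loss _ _)); rewrite big_enum.
Qed.

(** The Efron-Stein inequality. The squared increases and the squared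
    decreases of [f] under resampling have the same mean by exchangeability, so
    it suffices to bound the increases; this is what makes the inequality
    usable for minima. *)
Lemma efron_stein f (D : I -> V -> state -> R) :
  (forall i a v, f (upd v i a) - f v <= D i a v) ->
  (forall i a v, 0 <= D i a v) ->
  mean (fun v => (f v - mean f) ^+ 2) <=
  mean (fun v => \sum_i \sum_a p i a * D i a v ^+ 2).
Proof.
move=> fD D0; apply: (le_trans (variance_tensorization f)).
have -> : mean (fun v => \sum_i \sum_a p i a * D i a v ^+ 2) =
    \sum_i \sum_v \sum_a weight v * p i a * D i a v ^+ 2.
  rewrite exchange_big; apply: eq_bigr => v _; rewrite mulr_sumr.
  apply: eq_bigr => i _; rewrite mulr_sumr; apply: eq_bigr => a _.
  by rewrite mulrA.
apply: ler_sum => i _.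
pose dn v w := Num.max 0 (f v - f w) ^+ 2.
have split2 : 2 * mean (fun v => (f v - avg i f v) ^+ 2) <=
   \sum_v \sum_a weight v * p i a * dn v (upd v i a) +
   \sum_v \sum_a weight v * p i a * dn (upd v i a) v.
  have -> : 2 * mean (fun v => (f v - avg i f v) ^+ 2) = 
    \sum_v \sum_a weight v * p i a * (f v - f (upd v i a)) ^+ 2.
    rewrite avg_pythagoras.
    have -> : \sum_v \sum_a weight v * p i a * (f v - f (upd v i a)) ^+ 2 =
      \sum_v \sum_a weight v * p i a * f v ^+ 2 
      + \sum_v \sum_a weight v * p i a * f (upd v i a) ^+ 2
      - 2 * mean (fun v => f v * avg i f v).
      rewrite mean_avgE mulr_sumr -big_split -sumrB /=; apply: eq_bigr => v _.
      rewrite mulr_sumr -big_split -sumrB /=; apply: eq_bigr => a _; ring.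
    rewrite -(resample_swap i (fun v _ => f v ^+ 2)) sum_const.
    have -> : mean (fun v => f v * avg i f v) = mean (fun v => avg i f v ^+ 2).
      rewrite avg_selfadj (@eq_mean (fun v => avg i f v ^+ 2) (fun v =>
        avg i f v * avg i f v))//.
      by rewrite -avg_selfadj -[RHS]avg_selfadj; apply: eq_mean => v;
        rewrite avg_idem.
    by ring.
  rewrite -big_split /=; apply: ler_sum => v _.
  rewrite -big_split /=; apply: ler_sum => a _.
  rewrite -mulrDr ler_wpM2l ?mulr_ge0 ?weight_ge0// /dn.
  have [h|h] := leP (f v) (f (upd v i a)).
    rewrite max_l ?subr_le0// max_r ?subr_ge0// expr0n add0r.
    by rewrite -[leRHS]sqrrN opprB.
  rewrite max_r ?subr_ge0 ?(ltW h)// max_l ?subr_le0 ?(ltW h)//.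
  by rewrite expr0n addr0.
rewrite (resample_swap i dn) in split2.
have {}split2 : mean (fun v => (f v - avg i f v) ^+ 2) <=
    \sum_v \sum_a weight v * p i a * dn (upd v i a) v by lra.
apply: (le_trans split2); apply: ler_sum => v _; apply: ler_sum => a _.
rewrite ler_wpM2l ?mulr_ge0 ?weight_ge0//.
by rewrite ler_sqr ?nnegrE ?le_max ?lexx// ge_max D0 fD.
Qed.

(** Resampling the coordinate [i] increases a minimum of sums only if [i] occurs
    in the sum that is currently minimal, and then at most by the new value of
    [x i]. Hence the bound depends on the size of the minimizing sums and not
    on the number of coordinates. *)
Lemma variance_min_sum f (x : I -> V -> R) (A : state -> {set I}) (M : nat)
    (K : R) :
  0 <= K ->
  (forall i a, 0 <= x i a) ->
  (forall i, \sum_a p i a * x i a ^+ 2 <= K) ->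
  (forall v, (#|A v| <= M)%N) ->
  (forall v, f v = \sum_(i in A v) x i (v i)) ->
  (forall v w, f w <= \sum_(i in A v) x i (w i)) ->
  mean (fun v => (f v - mean f) ^+ 2) <= M%:R * K.
Proof.
move=> K0 x0 xK AM fE fle.
apply: (le_trans (@efron_stein f (fun i a v => (i \in A v)%:R * x i a) _ _)).
- move=> i a v; rewrite lerBlDr; apply: (le_trans (fle v _)).
  rewrite fE; have [iA|iA] := boolP (i \in A v).
    rewrite (bigD1 i)//= updE mul1r lerD2l.
    rewrite (eq_bigr (fun j => x j (v j))).
      by rewrite [leRHS](bigD1 i)//= ler_wpDl.
    by move=> j /andP[_ /negPf ji]; rewrite ffunE ji.
  rewrite mul0r add0r; apply: ler_sum => j jA; rewrite ffunE.
  by case: eqP => [ji|//]; rewrite -ji jA in iA.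
- by move=> i a v; rewrite mulr_ge0.
have -> : M%:R * K = mean (fun=> M%:R * K).
  by rewrite /mean -mulr_suml weight_sum1 mul1r.
apply: ler_mean => v.
apply: (@le_trans _ _ (\sum_(i in A v) K)).
  rewrite [leRHS]big_mkcond /=; apply: ler_sum => i _.
  case: (i \in A v) => /=.
    by under eq_bigr do rewrite mul1r; exact: xK.
  by rewrite big1// => a _; rewrite mul0r expr0n mulr0.
rewrite sumr_const -[leLHS]mulr_natl.
by rewrite ler_wpM2r// ler_nat.
Qed.

End ProductSpace.

(** * Walks and paths *)

Section Walks.
Local Open Scope fset_scope.
Local Open Scope ring_scope.
Context (d : nat).
Implicit Types (x y z : 'rV[int]_d) (h : edge d) (hs : seq (edge d)).

Definition direction : finType := ('I_d * bool)%type.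

Definition unit_step (a : direction) : 'rV[int]_d :=
  (-1) ^+ a.2 *: delta_mx ord0 a.1.

Lemma neighbours_unit_step x (a : direction) : neighbours x (x + unit_step a).
Proof.
rewrite /neighbours (bigD1 a.1)//= big1 ?addr0 => [|i ia].
  by rewrite !mxE !eqxx mulr1 opprD addNKr normrN normr_sign.
by rewrite !mxE (negPf ia) andbF mulr0 addr0 subrr normr0.
Qed.

Lemma neighboursP x y :
  neighbours x y -> exists a : direction, y = x + unit_step a.
Proof.
rewrite /neighbours => xy.
have [i xi] : exists i, x ord0 i != y ord0 i.
  apply/existsP; apply: contraTT xy; rewrite negb_exists => /forallP xy.
  rewrite big1// => i _; move: (xy i); rewrite negbK => /eqP ->.
  by rewrite subrr normr0.
move: xy; rewrite (bigD1 i)//= => /eqP xy.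
have rest0 : 0 <= \sum_(j | j != i) `|x ord0 j - y ord0 j| by apply: sumr_ge0.
have abs1 : `|x ord0 i - y ord0 i| >= 1 by rewrite -gtz0_ge1 normr_gt0 subr_eq0.
have rest : \sum_(j | j != i) `|x ord0 j - y ord0 j| = 0.
  by apply/eqP; rewrite eq_le rest0 andbT -(lerD2l `|x ord0 i - y ord0 i|) xy
    addr0.
move/eqP: (rest); rewrite psumr_eq0// => /allP others.
have xyj j : j != i -> y ord0 j = x ord0 j.
  move=> ji; have := others j (mem_index_enum _).
  by rewrite ji /= normr_eq0 subr_eq0 => /eqP.
exists (i, y ord0 i < x ord0 i); apply/rowP => j; rewrite !mxE eqxx /=.
have [->|/[dup]/xyj ->] := eqVneq j i; last by rewrite mulr0 addr0.
rewrite rest addr0 in xy; rewrite mulr1.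
move: (x ord0 i) (y ord0 i) xy => u v uv; case: ltP; rewrite ?expr0 ?expr1; lia.
Qed.

Lemma step_is_edge x (a : direction) : is_edge [fset x; x + unit_step a].
Proof.
by apply/asboolP; exists x, (x + unit_step a); split=> //;
  exact: neighbours_unit_step.
Qed.

Definition step_edge x a : edge d := Sub _ (step_is_edge x a).

(** Coding a walk by its successive directions shows that at most [(2 d) ^ m]
    walks of [m] edges start at a given point. *)
Fixpoint trail x (s : seq direction) : seq (edge d) :=
  if s is a :: s' then step_edge x a :: trail (x + unit_step a) s' else [::].

Lemma size_trail x s : size (trail x s) = size s.
Proof. by elim: s x => //= a s IH x; rewrite IH. Qed.

Lemma trail_cat_subseq x s s' : subseq (trail x s) (trail x (s ++ s')).
Proof. by elim: s x => [|a s IH] x /=; rewrite ?sub0seq ?eqxx ?IH. Qed.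

Lemma fset2_inj (K : choiceType) (a b c e : K) :
  [fset a; b] = [fset c; e] ->
  (a = c /\ b = e) \/ (a = e /\ b = c).
Proof.
move/fsetP => E.
have := E a; rewrite !inE eqxx /= => /esym /orP[] /eqP ac;
  have := E b; rewrite !inE eqxx orbT /= => /esym /orP[] /eqP bc; subst.
- by have := E e; rewrite !inE eqxx orbT orbb => /eqP ->; left.
- by left.
- by right.
- by have := E c; rewrite !inE eqxx orbb => /eqP ->; left.
Qed.

Lemma edge_step h x z : val h = [fset x; z] ->
  exists a : direction, z = x + unit_step a /\ h = step_edge x a.
Proof.
move=> hxz; have /asboolP[u [v [uv huv]]] := valP h.
have xz : neighbours x z.
  rewrite hxz in huv.
  case: (fset2_inj huv) => -[-> ->]//.
  move: uv; rewrite /neighbours => /eqP <-; apply/eqP.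
  by apply: eq_bigr => i _; rewrite distrC.
have [a za] := neighboursP xz; exists a; split=> //.
by apply: val_inj; rewrite hxz za.
Qed.

Lemma joins_trail x hs y : joins x hs y -> exists s, hs = trail x s.
Proof.
elim: hs x => [|h hs IH] x /=; first by exists [::].
case=> z [hxz /IH[s ->]].
by have [a [-> ->]] := edge_step hxz; exists (a :: s).
Qed.

Lemma trail_joins x s : joins x (trail x s) (x + \sum_(a <- s) unit_step a).
Proof.
elim: s x => [|a s IH] x /=; first by rewrite big_nil addr0.
exists (x + unit_step a); split=> //.
by rewrite big_cons addrA; exact: IH.
Qed.

Lemma joins_cat x hs hs' y :
  joins x (hs ++ hs') y <-> exists z, joins x hs z /\ joins z hs' y.
Proof.
elim: hs x => [|h hs IH] x /=; first by split=> [?|[z [->]]//]; exists x.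
split=> [[z [hz /IH[w [zw wy]]]]|[w [[z [hz zw]] wy]]].
  by exists w; split=> //; exists z.
by exists z; split=> //; apply/IH; exists w.
Qed.

Lemma joins_rev x hs y : joins x hs y -> joins y (rev hs) x.
Proof.
elim: hs x => [|h hs IH] x /=; first by move=> ->.
case=> z [hz /IH zy]; rewrite rev_cons -cats1; apply/joins_cat.
by exists z; split=> //=; exists x; split=> //; rewrite hz fsetUC.
Qed.

(** When an edge is traversed twice, everything between the two traversals can
    be cut out: together with one of them if they go in the same direction,
    together with both if they go in opposite directions. *)
Lemma loop_erasure x hs y : joins x hs y ->
  exists hs', is_path x y hs' /\ subseq hs' hs.
Proof.
have [k] := ubnP (size hs); elim: k hs => // k IH hs szk xy.
have [u|] := boolP (uniq hs); first by exists hs.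
have shorten hs1 : joins x hs1 y -> (size hs1 < size hs)%N -> subseq hs1 hs ->
    exists hs', is_path x y hs' /\ subseq hs' hs.
  move=> xy1 sz1 sub1.
  have [|hs' [p' sub']] := IH hs1 _ xy1; first exact: (leq_trans sz1).
  by exists hs'; split=> //; exact: subseq_trans sub1.
move=> nu.
have [hs1 [h [hs2 [hs3 E]]]] :
    exists hs1 h hs2 hs3, hs = hs1 ++ h :: hs2 ++ h :: hs3.
  elim: {IH szk xy shorten} hs nu => //= h hs IH; rewrite negb_and negbK.
  have [hin _|_ /IH[hs1 [h' [hs2 [hs3 ->]]]]] := boolP (h \in hs).
    by case/splitPr: hin => hs2 hs3; exists [::], h, hs2, hs3.
  by exists (h :: hs1), h', hs2, hs3.
subst hs; move/joins_cat: (xy) => [a [xa /= [b [hab]]]].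
case/joins_cat => c [bc /= [e [hce ey]]].
rewrite hab in hce; have [[ac be]|[ae bc']] := fset2_inj hce; subst.
- apply: (shorten (hs1 ++ h :: hs3)).
  + by apply/joins_cat; exists c; split=> //=; exists e.
  + by rewrite !size_cat /= !size_cat /=; lia.
  + apply: cat_subseq => //=; rewrite eqxx.
    exact: (subseq_trans (subseq_cons hs3 h) (suffix_subseq _ _)).
- apply: (shorten (hs1 ++ hs3)).
  + by apply/joins_cat; exists e.
  + by rewrite !size_cat /= !size_cat /=; lia.
  + apply: cat_subseq => //=.
    exact: (subseq_trans (subseq_cons hs3 h) (suffix_subseq (h :: hs2) _)).
Qed.

End Walks.

Section AxisWalk.
Context (d : nat) (d_gt0 : (0 < d)%N).

Definition axis_segment (n l : nat) : seq (edge d) :=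
  trail (axis_point d n) (nseq l (Ordinal d_gt0, false)).

Lemma axis_segment_joins n l :
  joins (axis_point d n) (axis_segment n l) (axis_point d (n + l)).
Proof.
have -> : axis_point d (n + l) = axis_point d n +
    \sum_(a <- nseq l (Ordinal d_gt0, false)) unit_step a.
  rewrite big_nseq iter_addr_0.
  apply/rowP => i; rewrite !mxE mulmxnE !mxE eqxx expr0 mul1r.
  have [i0|i0] := eqVneq (i : nat) 0%N.
    by rewrite -[i == _]/(i == 0%N :> nat) i0 eqxx -natz natrD natz.
  by rewrite -[i == _]/(i == 0%N :> nat) (negPf i0) mul0rn addr0.
exact: trail_joins.
Qed.

Lemma size_axis_segment n l : size (axis_segment n l) = l.
Proof. by rewrite size_trail size_nseq. Qed.

End AxisWalk.

Section MinimalTimes.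
Context (R : realType) (d : nat).
Implicit Types (t : edge d -> R) (hs : seq (edge d)).

Lemma path_time_ge0 t hs : (forall e, 0 <= t e) -> 0 <= path_time t hs.
Proof. by move=> t0; apply: sumr_ge0. Qed.

Lemma path_time_subseq t hs hs' : (forall e, 0 <= t e) -> subseq hs hs' ->
  path_time t hs <= path_time t hs'.
Proof.
move=> t0; rewrite /path_time.
elim: hs' hs => [|h' hs' IH] [|h hs]//=.
- by move=> _; rewrite big_nil sumr_ge0.
- case: eqP => [-> /IH|_ /IH le]; first by rewrite !big_cons lerD2l.
  by rewrite [leRHS]big_cons; apply: (le_trans le); rewrite lerDr.
Qed.

Definition paths_upto (n M : nat) : seq (seq (edge d)) :=
  [seq hs <- flatten [seq [seq trail 0 (tval s) | s : m.-tuple (direction d)]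
                     | m <- iota 0 M.+1]
  | `[< is_path 0 (axis_point d n) hs >]].

Lemma paths_uptoP n M hs :
  reflect (is_path 0 (axis_point d n) hs /\ (size hs <= M)%N)
    (hs \in paths_upto n M).
Proof.
rewrite mem_filter; apply: (iffP andP) => [[/asboolP p]|[p szM]].
  case/flatten_mapP => m; rewrite mem_iota /= add0n ltnS => mM.
  by case/mapP => s _ E; split=> //; rewrite E size_trail size_tuple.
split; first exact/asboolP.
have [s E] := joins_trail p.1; rewrite {}E size_trail in szM p *.
apply/flatten_mapP; exists (size s); first by rewrite mem_iota.
by apply/mapP; exists (in_tuple s); rewrite ?mem_enum.
Qed.

(** The default value of the minimum is one of the minimized values whenever the
    list of paths is not empty. *)
Definition min_time t n M : R :=
  \big[Num.min/path_time t (head [::] (paths_upto n M))]_(hs <- paths_upto n M)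
    path_time t hs.

Lemma min_time_le t n M hs : hs \in paths_upto n M ->
  min_time t n M <= path_time t hs.
Proof. by move=> hsP; rewrite /min_time; exact: ge_bigmin_seq. Qed.

Lemma min_time_attained t n M : (0 < size (paths_upto n M))%N ->
  exists2 hs, hs \in paths_upto n M & min_time t n M = path_time t hs.
Proof.
rewrite /min_time; set P := paths_upto n M => sP.
suff : forall s : seq (seq (edge d)), {subset s <= P} -> exists2 hs, hs \in P &
   \big[Num.min/path_time t (head [::] P)]_(hs <- s) path_time t hs = path_time
     t hs.
  by apply.
elim=> [_|hs s IH sub].
  by rewrite big_nil; exists (head [::] P) => //; case: (P) sP => //= *;
    rewrite mem_head.
have [|hs' hs'P E] := IH; first by move=> u us; rewrite sub// inE us orbT.
rewrite big_cons E; case: leP => _; [exists hs|exists hs'] => //.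
by rewrite sub// mem_head.
Qed.

End MinimalTimes.

(** * Passage times *)

Section PassageTime.
Context (R : realType) (d : nat) (d_gt0 : (0 < d)%N).
Context (t : edge d -> R) (t_ge0 : forall e, 0 <= t e).

Lemma axis_pointE0 : axis_point d 0 = 0.
Proof. by apply/rowP => i; rewrite !mxE; case: eqP. Qed.

Lemma walk_to_path x y (hs : seq (edge d)) : joins x hs y ->
  exists hs', [/\ is_path x y hs', (size hs' <= size hs)%N &
                  path_time t hs' <= path_time t hs].
Proof.
move=> /loop_erasure[hs' [p' sub]]; exists hs'; split=> //.
  exact: size_subseq.
exact: path_time_subseq.
Qed.

Definition axis_time (n l : nat) : R := path_time t (axis_segment d_gt0 n l).

Lemma axis_walk n : joins 0 (axis_segment d_gt0 0 n) (axis_point d n).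
Proof. by rewrite -[X in joins X]axis_pointE0; exact: axis_segment_joins. Qed.

Lemma axis_time_path n : exists hs, [/\ is_path 0 (axis_point d n) hs,
  (size hs <= n)%N & path_time t hs <= axis_time 0 n].
Proof.
have [hs [p sz le]] := walk_to_path (axis_walk n).
by exists hs; rewrite size_axis_segment in sz.
Qed.

Lemma axis_time_mono n l l' : (l <= l')%N -> axis_time n l <= axis_time n l'.
Proof.
move=> ll'; apply: path_time_subseq => //.
by rewrite /axis_segment -(subnKC ll') nseqD trail_cat_subseq.
Qed.

Lemma passage_set_has_inf n :
  has_inf [set path_time t hs | hs in is_path 0 (axis_point d n)].
Proof.
split; last by exists 0 => _ [hs _ <-]; exact: path_time_ge0.
by have [hs [p _ _]] := axis_time_path n; exists (path_time t hs), hs.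
Qed.

Lemma passage_time_le n hs : is_path 0 (axis_point d n) hs ->
  passage_time t n <= path_time t hs.
Proof.
move=> p; apply: ge_inf; first by case: (passage_set_has_inf n).
by exists hs.
Qed.

Lemma passage_time_ge0 n : 0 <= passage_time t n.
Proof.
apply: lb_le_inf; first by case: (passage_set_has_inf n).
by move=> _ [hs _ <-]; exact: path_time_ge0.
Qed.

Lemma passage_time_adherent n e : 0 < e ->
  exists2 hs, is_path 0 (axis_point d n) hs & path_time t hs < passage_time t n
    + e.
Proof.
move=> e0; have [_ [hs p <-] lt] := inf_adherent e0 (passage_set_has_inf n).
by exists hs.
Qed.

(** A nearly optimal path to the first point followed by the walk may repeat
    edges; erasing its loops only makes it faster. *)
Lemma passage_time_walk n n' hs : joins (axis_point d n) hs (axis_point d n') ->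
  passage_time t n' <= passage_time t n + path_time t hs.
Proof.
move=> nn'; apply/ler_addgt0Pr => e e0.
have [hs0 [p0 _] lt] := passage_time_adherent n e0.
have [|hs' [p' _ le]] := @walk_to_path 0 (axis_point d n') (hs0 ++ hs).
  by apply/joins_cat; exists (axis_point d n).
apply: (le_trans (passage_time_le p')); apply: (le_trans le).
by rewrite /path_time big_cat /= -!/(path_time _ _); lra.
Qed.

Lemma path_time_rev (hs : seq (edge d)) : path_time t (rev hs) = path_time t hs.
Proof. by rewrite /path_time; apply: perm_big; rewrite perm_rev. Qed.

Lemma passage_time_lipschitz n l :
  `|passage_time t (n + l) - passage_time t n| <= axis_time n l.
Proof.
have seg := axis_segment_joins d_gt0 n l.
have le1 := passage_time_walk seg.
have := passage_time_walk (joins_rev seg); rewrite path_time_rev => le2.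
by rewrite ler_norml; apply/andP; rewrite /axis_time; split; lra.
Qed.

Lemma paths_upto_gt0 n M : (n <= M)%N -> (0 < size (paths_upto d n M))%N.
Proof.
move=> nM; have [hs [p sz _]] := axis_time_path n.
have : hs \in paths_upto d n M by apply/paths_uptoP; rewrite (leq_trans sz).
by case: paths_upto.
Qed.

Lemma passage_le_min_time n M : (n <= M)%N ->
  passage_time t n <= min_time t n M.
Proof.
move=> /paths_upto_gt0/(min_time_attained t)[hs /paths_uptoP[p _] ->].
exact: passage_time_le.
Qed.

Lemma min_time_le_axis n M : (n <= M)%N -> min_time t n M <= axis_time 0 n.
Proof.
move=> nM; have [hs [p sz le]] := axis_time_path n.
apply: le_trans le; apply: min_time_le; apply/paths_uptoP.
by split=> //; exact: leq_trans nM.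
Qed.

(** A path that beats all paths of at most [M] edges has more than [M] edges;
    its first [M] edges cost no more than the straight path. *)
Lemma long_cheap_trail n M : (n <= M)%N -> passage_time t n < min_time t n M ->
  exists s : M.-tuple (direction d),
    uniq (trail 0 s) /\ path_time t (trail 0 s) <= axis_time 0 n.
Proof.
move=> nM lt.
have [hs p] := @passage_time_adherent n (min_time t n M - passage_time t n)
  ltac:(by rewrite subr_gt0).
rewrite addrC subrK => lths.
have szM : (M < size hs)%N.
  rewrite ltnNge; apply/negP => szM.
  have /(min_time_le t) : hs \in paths_upto d n M by apply/paths_uptoP.
  by rewrite leNgt lths.
have [s E] := joins_trail p.1; rewrite E size_trail in szM.
have sz : size (take M s) == M by rewrite size_takel// ltnW.
have sub : subseq (trail 0 (take M s)) hs.
  by have := trail_cat_subseq 0 (take M s) (drop M s); rewrite cat_take_drop E.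
exists (Tuple sz); split; first exact: (subseq_uniq sub p.2).
apply: (le_trans (path_time_subseq t_ge0 sub)).
by apply: (le_trans (ltW lths)); exact: min_time_le_axis.
Qed.

(** Every path is counted for large [M]; this yields the measurability of the
    passage time. *)
Lemma min_time_cvg n : min_time t n (n + M)%N @[M --> \oo] --> passage_time t n.
Proof.
apply/cvgrPdist_le => e e0.
have [hs p lt] := passage_time_adherent n e0.
exists (size hs) => // M /= szM.
have le := passage_le_min_time (leq_addr M n).
have : min_time t n (n + M) <= path_time t hs.
  by apply: min_time_le; apply/paths_uptoP; split=> //;
    rewrite (leq_trans szM)// leq_addl.
by move=> ?; rewrite ler_norml; apply/andP; split; lra.
Qed.

(** Paths do not repeat edges, so changing the edge times changes each path time
    by at most the total change over the edges concerned. *)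
Lemma min_time_dist (t' : edge d -> R) n M (J : {fset edge d}) : (n <= M)%N ->
  (forall hs, hs \in paths_upto d n M -> {subset hs <= J}) ->
  `|min_time t n M - min_time t' n M| <= \sum_(e <- J) `|t e - t' e|.
Proof.
move=> nM PJ.
have pathdist hs (u v : edge d -> R) : hs \in paths_upto d n M ->
   path_time u hs <= path_time v hs + \sum_(e <- J) `|u e - v e|.
  move=> hsP; have /paths_uptoP[[_ un] _] := hsP.
  rewrite -lerBlDl /path_time -sumrB.
  apply: (@le_trans _ _ (\sum_(e <- hs) `|u e - v e|)).
    by apply: ler_sum => e _; exact: ler_norm.
  rewrite (perm_big [seq e <- J | e \in hs]).
    by rewrite big_filter [leRHS](bigID (mem hs))/= lerDl sumr_ge0.
  apply: uniq_perm => //; first exact/filter_uniq/fset_uniq.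
  by move=> e; rewrite mem_filter andb_idr//; exact: PJ.
have [hs hsP E] := min_time_attained t (paths_upto_gt0 nM).
have [hs' hsP' E'] := min_time_attained t' (paths_upto_gt0 nM).
have le := le_trans (min_time_le t hsP') (pathdist hs' t t' hsP').
have := le_trans (min_time_le t' hsP) (pathdist hs t' t hsP).
under eq_bigr do rewrite distrC.
by move=> le'; rewrite ler_norml; apply/andP; split; lra.
Qed.

End PassageTime.

(** * Expectations of nonnegative functions *)

Section Expectations.
Context (R : realType) (disp : measure_display) (Omega : measurableType disp)
  (P : probability Omega R).
Implicit Types f g : Omega -> R.

(** Extended real values spare integrability conditions, as long as the
    functions are nonnegative. *)
Definition expect f : \bar R := (\int[P]_w (f w)%:E)%E.

Lemma expect_ge0 f : (forall w, 0 <= f w) -> (0 <= expect f)%E.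
Proof. by move=> f0; apply: integral_ge0 => w _; rewrite lee_fin. Qed.

Lemma expect_le f g : measurable_fun setT f -> measurable_fun setT g ->
  (forall w, 0 <= f w) -> (forall w, f w <= g w) -> (expect f <= expect g)%E.
Proof.
move=> mf mg f0 fg; apply: ge0_le_integral => //.
- by move=> w _; rewrite lee_fin.
- exact/measurable_EFinP.
- exact/measurable_EFinP.
- by move=> w _; rewrite lee_fin.
Qed.

Lemma expect_add f g : measurable_fun setT f -> measurable_fun setT g ->
  (forall w, 0 <= f w) -> (forall w, 0 <= g w) ->
  expect (fun w => f w + g w) = (expect f + expect g)%E.
Proof.
move=> mf mg f0 g0; rewrite /expect -ge0_integralD//.
- by move=> w _; rewrite lee_fin.
- exact/measurable_EFinP.
- by move=> w _; rewrite lee_fin.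
- exact/measurable_EFinP.
Qed.

Lemma expect_scale k f : measurable_fun setT f -> (forall w, 0 <= f w) ->
  0 <= k ->
  expect (fun w => k * f w) = (k%:E * expect f)%E.
Proof.
move=> mf f0 k0; rewrite /expect -ge0_integralZl_EFin//.
- by move=> w _; rewrite lee_fin.
- exact/measurable_EFinP.
Qed.

Lemma expect_sum (I : Type) (s : seq I) (F : I -> Omega -> R) :
  (forall i, measurable_fun setT (F i)) -> (forall i w, 0 <= F i w) ->
  expect (fun w => \sum_(i <- s) F i w) = (\sum_(i <- s) expect (F i))%E.
Proof.
move=> mF F0; rewrite /expect -ge0_integral_sum//.
- by apply: eq_integral => w _; rewrite sumEFin.
- by move=> i; exact/measurable_EFinP.
- by move=> i w _; rewrite lee_fin.
Qed.

Lemma expect_cst k : expect (fun=> k) = k%:E.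
Proof.
rewrite /expect integral_cst//.
by rewrite [X in (_ * X)%E](_ : _ = 1%E) ?mule1//; exact: probability_setT.
Qed.

Lemma expect_indic (A : set Omega) : measurable A -> expect (\1_A) = P A.
Proof. by move=> mA; rewrite /expect integral_indic// setIT. Qed.

Lemma expect_eq f g : f =1 g -> expect f = expect g.
Proof. by move=> fg; apply: eq_integral => w _; rewrite fg. Qed.

Section FiniteLaw.
Context (S : finType) (X : Omega -> S).
Hypothesis mX : forall a, measurable (X @^-1` [set a]).

Lemma finite_valuedE (g : S -> R) w :
  g (X w) = \sum_a g a * \1_(X @^-1` [set a]) w.
Proof.
rewrite (bigD1 (X w))//= big1 => [|a aX].
  by rewrite indicE mem_set// mulr1 addr0.
by rewrite indicE memNset ?mulr0//= => /esym/eqP; apply/negP.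
Qed.

Lemma finite_valued_measurable (g : S -> R) :
  measurable_fun setT (fun w => g (X w)).
Proof.
rewrite (_ : (fun w => g (X w)) =
  fun w => \sum_a g a * \1_(X @^-1` [set a]) w); last first.
  by apply/funext => w; exact: finite_valuedE.
by apply: measurable_sum => a; apply: measurable_funM.
Qed.

Lemma expect_finite_valued (g : S -> R) : (forall a, 0 <= g a) ->
  expect (fun w => g (X w)) = (\sum_a fine (P (X @^-1` [set a])) * g a)%:E.
Proof.
move=> g0; rewrite (expect_eq (finite_valuedE g)) expect_sum.
- rewrite -sumEFin; apply: eq_bigr => a _.
  rewrite expect_scale//.
  by rewrite expect_indic// EFinM fineK ?fin_num_measure// muleC.
- by move=> a; exact: measurable_funM.
- by move=> a w; rewrite mulr_ge0.
Qed.

End FiniteLaw.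
End Expectations.

(** * Rounding to a finite grid *)

Section Grid.
Context (R : realType) (N : nat) (N_gt0 : (0 < N)%N).
Implicit Types x y : R.

(** Rounding down to the multiples of [1 / N], with a cap at [N] that leaves
    finitely many values. *)
Definition grid_index x : 'I_(N * N).+1 :=
  inord (minn (Num.truncn (N%:R * x)) (N * N)).

Definition grid_value (a : 'I_(N * N).+1) : R := a%:R / N%:R.

Lemma grid_indexE x :
  grid_index x = minn (Num.truncn (N%:R * x)) (N * N) :> nat.
Proof. by rewrite inordK// ltnS geq_minr. Qed.

Lemma grid_value_ge0 a : 0 <= grid_value a.
Proof. by rewrite divr_ge0. Qed.

Lemma grid_index_mono x y : x <= y -> (grid_index x <= grid_index y)%N.
Proof.
move=> xy; rewrite !grid_indexE leq_min geq_minr andbT.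
by rewrite geq_min le_truncn ?ler_wpM2l.
Qed.

Lemma grid_index_measurable a : measurable [set x | grid_index x = a].
Proof.
apply: is_interval_measurable => x y /= xa ya z /andP[xz zy].
apply/val_inj/eqP; rewrite eqn_leq.
by apply/andP; split; [rewrite -ya|rewrite -xa]; exact: grid_index_mono.
Qed.

(** Below the cap [N] the rounding error is at most [1 / N]; above it the error
    is at most [x], which is at most [x ^+ 2 / N]. *)
Lemma grid_error x : 0 <= x ->
  0 <= x - grid_value (grid_index x) <= (1 + x ^+ 2) / N%:R.
Proof.
move=> x0; rewrite /grid_value grid_indexE.
have N0 : (0 : R) < N%:R by rewrite ltr0n.
have Nx0 : 0 <= N%:R * x by rewrite mulr_ge0.
have /andP[lo hi] := truncn_itv Nx0.
set k := Num.truncn _ in lo hi *.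
rewrite subr_ge0 ler_pdivrMr// [x * _]mulrC.
have min_le : (minn k (N * N))%:R <= N%:R * x.
  by apply: le_trans lo; rewrite ler_nat geq_minl.
rewrite min_le /= ler_pdivlMr// mulrBl divfK ?gt_eqF// [x * _]mulrC.
have [kN|kN] := leqP k (N * N).
  move: hi; rewrite -natr1 => hi; have := sqr_ge0 x; lra.
have : N%:R <= x.
  rewrite -(ler_pM2l N0) -natrM; apply: le_trans lo.
  by rewrite ler_nat ltnW.
rewrite natrM => Nx; have := ler_wpM2r x0 Nx; have := sqr_ge0 (N%:R : R).
rewrite !expr2; lra.
Qed.

End Grid.

(** * Discretized independent variables *)

(** The double sum of [(a i - a j) ^+ 2] is nonnegative. *)
Lemma sqr_sum_le (R : realDomainType) (I : Type) (s : seq I) (a : I -> R) :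
  (\sum_(i <- s) a i) ^+ 2 <= (size s)%:R * \sum_(i <- s) a i ^+ 2.
Proof.
have : 0 <= \sum_(i <- s) \sum_(j <- s) (a i - a j) ^+ 2.
  by apply: sumr_ge0 => i _; apply: sumr_ge0 => j _; exact: sqr_ge0.
have -> : \sum_(i <- s) \sum_(j <- s) (a i - a j) ^+ 2 =
    2 * ((size s)%:R * \sum_(i <- s) a i ^+ 2 - (\sum_(i <- s) a i) ^+ 2).
  set Q := \sum_(i <- s) a i ^+ 2; set S := \sum_(i <- s) a i.
  transitivity (\sum_(i <- s) ((size s)%:R * a i ^+ 2 + Q - 2 * S * a i)).
    apply: eq_bigr => i _.
    transitivity (\sum_(j <- s) (a i ^+ 2 + a j ^+ 2 - 2 * a i * a j)).
      by apply: eq_bigr => j _; ring.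
    rewrite sumrB big_split /= -[X in _ - X]mulr_sumr big_const_seq count_predT
      iter_addr_0.
    by rewrite -/S -/Q -[_ *+ size s]mulr_natl; ring.
  rewrite sumrB big_split /= -[X in _ - X]mulr_sumr -[X in X +
    _ - _]mulr_sumr -/Q -/S.
  by rewrite big_const_seq count_predT iter_addr_0 -[_ *+ size s]mulr_natl;
    ring.
by rewrite pmulr_rge0// subr_ge0.
Qed.

Lemma sqr_add_le (R : realDomainType) (a b : R) :
  (a + b) ^+ 2 <= 2 * a ^+ 2 + 2 * b ^+ 2.
Proof. by have := sqr_ge0 (a - b); rewrite !expr2; lra. Qed.

Section FiniteDimensionalLaw.
Context (R : realType) (disp : measure_display) (Omega : measurableType disp)
  (P : probability Omega R) (I : choiceType) (X : I -> {RV P >-> R}).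
Hypothesis X_indep : mutually_independent X.
Context (J : {fset I}) (V : finType) (D : R -> V).
Hypothesis mD : forall a, measurable [set x | D x = a].

Definition discrete_law (i : J) (a : V) : R :=
  fine (P [set w | D (X (val i) w) = a]).

Definition discretized (w : Omega) : {ffun J -> V} :=
  [ffun i => D (X (val i) w)].

Lemma discrete_measurable (i : I) a : measurable [set w | D (X i w) = a].
Proof.
rewrite (_ : [set w | _] = X i @^-1` [set x | D x = a])//.
by rewrite -[X in measurable X]setTI; exact: measurable_funP.
Qed.

Lemma discretized_preimage (v : {ffun J -> V}) :
  discretized @^-1` [set v] =
  \bigcap_(i in [set i | i \in J])
    (X i @^-1` [set x | if insub i is Some j then D x = v j else True]).
Proof.
apply/seteqP; split=> w /=.
  by move=> <- i iJ /=; rewrite insubT/= /discretized ffunE.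
move=> H; apply/ffunP => i; rewrite ffunE.
by have := H (val i) (valP i); rewrite /= valK.
Qed.

Lemma level_measurable (v : {ffun J -> V}) i :
  measurable [set x | if insub i is Some j then D x = v j else True].
Proof. by case: insubP => [j _ _|_]; [exact: mD|exact: measurableT]. Qed.

Lemma discretized_measurable v : measurable (discretized @^-1` [set v]).
Proof.
rewrite discretized_preimage; apply: fin_bigcap_measurable.
  exact: finite_fset.
by move=> i _; rewrite -[X in measurable X]setTI; apply: measurable_funP => //;
  exact: level_measurable.
Qed.

(** This is where independence is used: the joint law of finitely many
    discretized variables is a product law on a finite space. *)
Lemma discretized_law v :
  fine (P (discretized @^-1` [set v])) = weight discrete_law v.
Proof.
rewrite discretized_preimage X_indep; last by move=> i _;
  exact: level_measurable.
rewrite big_seq_fsetE /= /weight.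
rewrite (eq_bigr (fun i => (discrete_law i (v i))%:E));
  first by rewrite prodEFin.
move=> i _; rewrite valK /discrete_law fineK ?fin_num_measure//.
exact: discrete_measurable.
Qed.

Lemma discrete_law_ge0 i a : 0 <= discrete_law i a.
Proof. by rewrite fine_ge0. Qed.

Lemma discrete_law_mean (i : J) (g : V -> R) : (forall a, 0 <= g a) ->
  expect P (fun w => g (D (X (val i) w))) = (\sum_a discrete_law i a * g a)%:E.
Proof.
move=> g0; rewrite (@expect_finite_valued _ _ _ _ _ (fun w =>
  D (X (val i) w)))//.
by move=> a; exact: discrete_measurable.
Qed.

Lemma discrete_law_sum1 i : \sum_a discrete_law i a = 1.
Proof.
have := @discrete_law_mean i (fun=> 1) (fun=> ler01).
by rewrite expect_cst => -[->]; apply: eq_bigr => a _; rewrite mulr1.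
Qed.

Lemma discretized_mean (g : {ffun J -> V} -> R) : (forall v, 0 <= g v) ->
  expect P (fun w => g (discretized w)) = (mean discrete_law g)%:E.
Proof.
move=> g0; rewrite expect_finite_valued//; last exact: discretized_measurable.
by congr EFin; apply: eq_bigr => v _; rewrite discretized_law.
Qed.

End FiniteDimensionalLaw.

(** * Variance of the minimum over paths of bounded size *)

Section MinTimeVariance.
Context (R : realType) (disp : measure_display) (Omega : measurableType disp)
  (P : probability Omega R) (d : nat) (d_gt0 : (0 < d)%N)
  (t : edge d -> {RV P >-> R}).
Hypothesis t_ge0 : forall e w, 0 <= t e w.
Hypothesis t_indep : mutually_independent t.
Context (K : R) (K_ge0 : 0 <= K).
Hypothesis t_moment4 : forall e, (expect P (fun w => t e w ^+ 4)%R <= K%:E)%E.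

Lemma t_measurable e : measurable_fun setT (t e).
Proof. exact: measurable_funP. Qed.

Lemma moment_sqr e : (expect P (fun w => (1 + t e w ^+ 2) ^+ 2)%R <=
  (2 + 2 * K)%R%:E)%E.
Proof.
have m2 := measurable_funX 2 (t_measurable e).
have m4 := measurable_funX 4 (t_measurable e).
apply: (@le_trans _ _ (expect P (fun w => 2 + 2 * t e w ^+ 4)%R)).
  apply: expect_le.
  - by apply: measurable_funX; apply: measurable_funD.
  - by apply: measurable_funD => //; apply: measurable_funM.
  - by move=> w; exact: sqr_ge0.
  - move=> w; rewrite -(subr_ge0 (_ ^+ 2)).
    have -> : 2 + 2 * t e w ^+ 4 - (1 + t e w ^+ 2) ^+ 2 =
      (1 - t e w ^+ 2) ^+ 2.
      ring.
    exact: sqr_ge0.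
rewrite expect_add//.
- rewrite expect_cst expect_scale//; last by move=> w; rewrite exprn_ge0.
  by rewrite (EFinD 2) leeD2l// EFinM lee_wpmul2l// lee_fin.
- by apply: measurable_funM.
- by move=> w; rewrite mulr_ge0// exprn_ge0.
Qed.

Lemma min_time_measurable n M : (n <= M)%N ->
  measurable_fun setT (fun w => min_time (fun e => t e w) n M).
Proof.
move=> nM; rewrite /min_time.
have mpath hs : measurable_fun setT (fun w => path_time (fun e => t e w) hs).
  by apply: measurable_sum => e; exact: t_measurable.
elim: (paths_upto d n M) (head _ _) => [|hs s IH] hs0.
  by under eq_fun do rewrite big_nil; exact: mpath.
under eq_fun do rewrite big_cons.
apply: measurable_minr => //; exact: IH.
Qed.

Lemma grid_time_measurable N e :
  measurable_fun setT (fun w => grid_value R (grid_index N (t e w : R))).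
Proof.
apply: (@finite_valued_measurable _ _ _ _ (fun w =>
  grid_index N (t e w : R))) => a.
by apply: (@discrete_measurable _ _ _ _ _ t _ (grid_index N));
  exact: grid_index_measurable.
Qed.


Section Discretization.
Context (n M : nat) (nM : (n <= M)%N) (N : nat) (N_gt0 : (0 < N)%N).

Definition path_edges : {fset edge d} :=
  [fset e in flatten (paths_upto d n M)]%fset.

Lemma path_edges_sub hs : hs \in paths_upto d n M -> {subset hs <= path_edges}.
Proof. by move=> hsP e ehs; rewrite !inE; apply/flattenP; exists hs. Qed.

Local Notation state := {ffun path_edges -> 'I_(N * N).+1}.

Definition grid_times (v : state) (e : edge d) : R :=
  if insub e is Some i then grid_value R (v i) else 0.

Definition grid_min_time (v : state) : R := min_time (grid_times v) n M.

Definition used_edges (hs : seq (edge d)) : {set path_edges} :=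
  finset (fun i : path_edges => val i \in hs).

Lemma path_time_grid hs (v : state) : hs \in paths_upto d n M ->
  path_time (grid_times v) hs = \sum_(i in used_edges hs) grid_value R (v i).
Proof.
move=> hsP; have /paths_uptoP[[_ un] _] := hsP.
rewrite /path_time (perm_big [seq e <- path_edges | e \in hs]) /=.
  rewrite big_filter big_seq_fsetE /=; apply: eq_big => i; first by rewrite inE.
  by move=> _; rewrite /grid_times valK.
apply: uniq_perm => //; first exact/filter_uniq/fset_uniq.
by move=> e; rewrite mem_filter andb_idr//; exact: path_edges_sub.
Qed.

Lemma card_used_edges hs : (#|used_edges hs| <= size hs)%N.
Proof.
rewrite cardE -(size_map val); apply: uniq_leq_size.
  by rewrite map_inj_uniq ?enum_uniq//; exact: val_inj.
by move=> e /mapP[i]; rewrite mem_enum inE => ? ->.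
Qed.

Let D : R -> 'I_(N * N).+1 := grid_index N.
Let X : Omega -> state := @discretized _ _ _ P _ t path_edges _ D.
Let law := @discrete_law _ _ _ P _ t path_edges _ D.

Let mD a : measurable [set x | D x = a].
Proof. exact: grid_index_measurable. Qed.

(** The minimizing path has at most [M] edges, so [variance_min_sum] applies to
    the rounded edge times. *)
Lemma grid_variance :
  mean law (fun v => (grid_min_time v - mean law grid_min_time) ^+ 2) <=
  M%:R * (2 + 2 * K).
Proof.
have nonempty := paths_upto_gt0 d_gt0 (t := fun=> 0 : R) (fun=> lexx 0) nM.
pose opt (v : state) := projT1 (cid2 (min_time_attained
  (grid_times v) nonempty)).
have optP v : opt v \in paths_upto d n M by rewrite /opt; case: cid2.
have optE v : grid_min_time v = path_time (grid_times v) (opt v).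
  by rewrite /opt; case: cid2.
apply: (@variance_min_sum _ _ _ law _ _ _ (fun _ a => grid_value R a)
  (fun v => used_edges (opt v))).
- exact: discrete_law_ge0.
- exact: discrete_law_sum1.
- by rewrite addr_ge0// mulr_ge0.
- by move=> _ a; exact: grid_value_ge0.
- move=> e; rewrite -lee_fin -discrete_law_mean//; last first.
    by move=> a; exact: sqr_ge0.
  apply: le_trans (moment_sqr (val e)); apply: expect_le.
  + by apply: measurable_funX; exact: grid_time_measurable.
  + apply: measurable_funX; apply: measurable_funD => //.
    by apply: measurable_funX; exact: t_measurable.
  + by move=> w; exact: sqr_ge0.
  + move=> w; have t0 := t_ge0 (val e) w.
    have /andP[lo _] := grid_error N_gt0 t0.
    have g0 := grid_value_ge0 R (D (t (val e) w)).
    have s1 : grid_value R (D (t (val e) w)) <= 1 + t (val e) w ^+ 2.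
      rewrite subr_ge0 in lo; apply: (le_trans lo).
      by have := sqr_ge0 (t (val e) w - 1); have := sqr_ge0 (t (val e) w : R);
        rewrite !expr2; lra.
    by rewrite ler_sqr// nnegrE (le_trans g0).
- move=> v; apply: (leq_trans (card_used_edges _)).
  by have /paths_uptoP[] := optP v.
- by move=> v; rewrite optE path_time_grid.
- move=> v v'; rewrite -path_time_grid//; exact: min_time_le.
Qed.

Lemma grid_min_time_dist w :
  `|min_time (fun e => t e w) n M - grid_min_time (X w)| <=
  \sum_(e <- path_edges) (1 + t e w ^+ 2) / N%:R.
Proof.
apply: (le_trans (@min_time_dist _ _ d_gt0 _ _ _ _ _ path_edges nM _)).
- by move=> e; exact: t_ge0.
- exact: path_edges_sub.
rewrite [leLHS]big_seq [leRHS]big_seq; apply: ler_sum => e eJ.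
have /andP[lo hi] := grid_error N_gt0 (t_ge0 e w).
by rewrite /grid_times insubT ffunE /= ger0_norm.
Qed.

Lemma grid_approximation : (#|` path_edges| <= N)%N ->
  (expect P (fun w => (min_time (fun e => t e w) n M - grid_min_time
    (X w)) ^+ 2)%R
   <= (2 + 2 * K)%R%:E)%E.
Proof.
move=> JN; set J := path_edges in JN *.
have mt e : measurable_fun setT (fun w => (1 + t e w ^+ 2) ^+ 2).
  apply: measurable_funX; apply: measurable_funD => //.
  by apply: measurable_funX; exact: t_measurable.
have N0 : (0 : R) < N%:R by rewrite ltr0n.
apply: (@le_trans _ _ (expect P (fun w =>
    N%:R^-1 * \sum_(e <- J) (1 + t e w ^+ 2) ^+ 2)%R)).
  apply: expect_le.
  - apply: measurable_funX; apply: measurable_funB;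
      first exact: min_time_measurable.
    by apply: finite_valued_measurable => v; exact: discretized_measurable.
  - by apply: measurable_funM => //; exact: measurable_sum.
  - by move=> w; exact: sqr_ge0.
  - move=> w; rewrite -real_normK ?num_real//.
    apply: (@le_trans _ _ ((\sum_(e <- J) (1 + t e w ^+ 2) / N%:R) ^+ 2)).
      rewrite ler_sqr ?nnegrE ?normr_ge0//; first exact: grid_min_time_dist.
      by rewrite sumr_ge0// => e _; rewrite divr_ge0// addr_ge0// sqr_ge0.
    rewrite -mulr_suml exprMn.
    have S0 : 0 <= \sum_(e <- J) (1 + t e w ^+ 2) ^+ 2.
      by apply: sumr_ge0 => e _; exact: sqr_ge0.
    rewrite mulrC expr2 -mulrA ler_pM2l ?invr_gt0// mulrC ler_pdivrMr//.
    apply: (le_trans (sqr_sum_le _ _)); rewrite mulrC ler_wpM2l//.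
    by rewrite ler_nat.
rewrite expect_scale ?invr_ge0//; last 2 first.
- exact: measurable_sum.
- by move=> w; apply: sumr_ge0 => e _; exact: sqr_ge0.
rewrite expect_sum//; last by move=> e w; exact: sqr_ge0.
apply: (@le_trans _ _ (N%:R^-1%:E * \sum_(e <- J) (2 + 2 * K)%R%:E)%E).
  by apply: lee_wpmul2l; rewrite ?lee_fin ?invr_ge0//; apply: lee_sum => e _;
    exact: moment_sqr.
rewrite sumEFin -EFinM lee_fin.
have -> : \sum_(e <- J) (2 + 2 * K) = (#|` J|)%:R * (2 + 2 * K).
  by rewrite big_const_seq count_predT iter_addr_0 -[LHS]mulr_natl.
rewrite mulrA ger_pMl; last by rewrite ltr_wpDr// mulr_ge0.
by rewrite mulrC ler_pdivrMr// mul1r ler_nat.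
Qed.

End Discretization.

(** The constant is the mean of the rounded minimum, for a grid so fine that the
    rounding errors of all the edges concerned add up to a bounded quantity. *)
Lemma min_time_variance n M : (n <= M)%N -> exists c : R,
  (expect P (fun w => (min_time (fun e => t e w) n M - c) ^+ 2)%R
   <= ((2 * M%:R + 2) * (2 + 2 * K))%R%:E)%E.
Proof.
move=> nM; pose N := #|` path_edges n M|.+1.
have N0 : (0 < N)%N by [].
set law := @discrete_law _ _ _ P _ t (path_edges n M) _ (grid_index N).
exists (mean law (@grid_min_time n M N)).
set c := mean _ _.
pose X := @discretized _ _ _ P _ t (path_edges n M) _ (grid_index N).
have mX := @discretized_measurable _ _ _ P _ t (path_edges n M) _ _
  (@grid_index_measurable R N).
have mG : measurable_fun setT (fun w => grid_min_time (X w)).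
  exact: finite_valued_measurable.
have mT := min_time_measurable nM.
apply: (@le_trans _ _ (expect P (fun w =>
  2 * (min_time (fun e => t e w) n M - grid_min_time (X w)) ^+ 2
  + 2 * (grid_min_time (X w) - c) ^+ 2)%R)).
  apply: expect_le.
  - by apply: measurable_funX; apply: measurable_funB.
  - apply: measurable_funD; apply: measurable_funM => //;
      apply: measurable_funX;
      exact: measurable_funB.
  - by move=> w; exact: sqr_ge0.
  - by move=> w; apply: le_trans (sqr_add_le _ _); rewrite subrKA.
rewrite expect_add; last 4 first.
- by apply: measurable_funM => //; apply: measurable_funX;
    exact: measurable_funB.
- by apply: measurable_funM => //; apply: measurable_funX;
    exact: measurable_funB.
- by move=> w; rewrite mulr_ge0// sqr_ge0.
- by move=> w; rewrite mulr_ge0// sqr_ge0.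
rewrite !expect_scale//; last 4 first.
- by apply: measurable_funX; exact: measurable_funB.
- by move=> w; exact: sqr_ge0.
- by apply: measurable_funX; exact: measurable_funB.
- by move=> w; exact: sqr_ge0.
rewrite (@discretized_mean _ _ _ P _ t t_indep _ _ _
  (@grid_index_measurable R N)
  (fun v => (grid_min_time v - c) ^+ 2)); last by move=> v; exact: sqr_ge0.
have -> : (2 * M%:R + 2) * (2 + 2 * K) =
  2 * (2 + 2 * K) + 2 * (M%:R * (2 + 2 * K)) by ring.
rewrite [leRHS]EFinD [in leRHS]EFinM; apply: leeD.
  by apply: lee_wpmul2l => //; apply: grid_approximation => //; exact: leqnSn.
by rewrite -EFinM lee_fin ler_wpM2l//; exact: grid_variance.
Qed.

End MinTimeVariance.

(** * Long paths with a small passage time are rare *)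

Lemma ler_term_sum (R : realDomainType) (I : eqType) (s : seq I) (p : pred I)
    (F : I -> R) i :
  (forall j, 0 <= F j) -> i \in s -> p i -> F i <= \sum_(j <- s | p j) F j.
Proof.
by move=> F0 si pi; rewrite (big_rem i)//= pi lerDl sumr_ge0.
Qed.

Lemma sum_const_seq (R : pzSemiRingType) (I : Type) (s : seq I) (x : R) :
  \sum_(i <- s) x = (size s)%:R * x.
Proof. by rewrite big_const_seq count_predT iter_addr_0 -[LHS]mulr_natl. Qed.

Lemma count_le_path_time (R : realType) (d : nat) (t : edge d -> R) eps hs :
  (forall e, 0 <= t e) -> 0 < eps ->
  eps * (count (fun e => eps <= t e) hs)%:R <= path_time t hs.
Proof.
move=> t0 eps0; rewrite /path_time; elim: hs => [|e hs IH] /=.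
  by rewrite mulr0 big_nil.
rewrite big_cons natrD mulrDr lerD//.
by case: (leP eps (t e)) => /= h; rewrite ?mulr1// mulr0.
Qed.

Section CheapTrails.
Context (R : realType) (disp : measure_display) (Omega : measurableType disp)
  (P : probability Omega R) (d : nat) (d_gt0 : (0 < d)%N)
  (t : edge d -> {RV P >-> R}).
Hypothesis t_ge0 : forall e w, 0 <= t e w.
Hypothesis t_indep : mutually_independent t.
Context (eps : R) (eps_gt0 : 0 < eps).
(* There are [(2 d) ^ (2 m)] trails of [2 m] edges from the origin and each has
   [2 ^ (2 m)] sets of edges: this value makes the union bound
   [(16 d ^ 2 delta) ^ m] equal to [2 ^ (- m)]. *)
Let delta : R := (32 * d%:R ^+ 2)^-1.
Hypothesis t_small : forall e, (P [set w | (t e w < eps)%R] <= delta%:E)%E.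

Let low : set R := [set x | x < eps].

Definition all_small (J : {fset edge d}) : set Omega :=
  \bigcap_(e in [set e | e \in J]) (t e @^-1` low).

Lemma small_measurable : measurable low.
Proof. by rewrite /low -set_itvNyo; exact: measurable_itv. Qed.

Lemma low_preimage_measurable e : measurable (t e @^-1` low).
Proof.
by rewrite -[X in measurable X]setTI; apply: measurable_funP => //;
  exact: small_measurable.
Qed.

Lemma all_small_measurable J : measurable (all_small J).
Proof.
apply: fin_bigcap_measurable; first exact: finite_fset.
by move=> e _; exact: low_preimage_measurable.
Qed.

Lemma delta_ge0 : 0 <= delta. Proof. by rewrite invr_ge0 mulr_ge0// exprn_ge0.
Qed.

Lemma delta_le1 : delta <= 1.
Proof.
have d1 : (1 : R) <= d%:R by rewrite ler1n.
rewrite invf_le1; last by rewrite mulr_gt0// exprn_gt0// ltr0n.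
have : (1 : R) <= d%:R ^+ 2 by rewrite exprn_ege1.
lra.
Qed.

Lemma all_small_prob (J : {fset edge d}) m : (m <= #|` J|)%N ->
  (P (all_small J) <= (delta ^+ m)%:E)%E.
Proof.
move=> mJ; rewrite /all_small t_indep; last by move=> *;
  exact: small_measurable.
have -> : (\prod_(i <- J) P (t i @^-1` low))%E =
  (\prod_(i <- J) fine (P (t i @^-1` low)))%:E.
  rewrite -prodEFin; apply: eq_bigr => e _.
  by rewrite fineK// fin_num_measure//; exact: low_preimage_measurable.
rewrite lee_fin; apply: (@le_trans _ _ (delta ^+ #|` J|)).
  have -> : delta ^+ #|` J| = \prod_(i <- J) delta.
    by rewrite big_const_seq count_predT iter_mulr_1.
  apply: ler_prod => e _; apply/andP; split; first exact: fine_ge0.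
  rewrite -lee_fin fineK//; first exact: t_small.
  by rewrite fin_num_measure//; exact: low_preimage_measurable.
by rewrite ler_wiXn2l// ?delta_ge0 ?delta_le1.
Qed.

(** A trail of [2 m] edges of time less than [eps * m] has at least [m] edges of
    time less than [eps]. This sum of indicators, over all trails and all sets
    of at least [m] of their edges, therefore dominates the indicator of the
    existence of such a trail, and its expectation is the union bound. *)
Definition cheap (m : nat) (w : Omega) : R :=
  \sum_(s : (m + m).-tuple (direction d) | uniq (trail 0 s))
    \sum_(J <- fpowerset [fset e in trail 0 s]%fset | (m <= #|` J|)%N)
      \1_(all_small J) w.

Lemma cheap_ge0 m w : 0 <= cheap m w.
Proof. by apply: sumr_ge0 => s _; apply: sumr_ge0 => J _. Qed.

Lemma cheap_measurable m : measurable_fun setT (cheap m).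
Proof.
rewrite /cheap; under eq_fun do rewrite big_mkcond.
apply: measurable_sum => s; case: (uniq (trail 0 s)) => //.
under eq_fun do rewrite big_mkcond.
apply: measurable_sum => J; case: (m <= #|` J|)%N => //.
by apply: measurable_indic; exact: all_small_measurable.
Qed.

Lemma cheap_ge1 m (s : (m + m).-tuple (direction d)) w :
  uniq (trail 0 s) -> path_time (fun e => t e w) (trail 0 s) < eps * m%:R ->
  1 <= cheap m w.
Proof.
move=> us lt.
pose small := [seq e <- trail 0 s | t e w < eps].
pose J := [fset e in small]%fset.
have Jsize : #|` J| = size small.
  by rewrite card_fseq undup_id// filter_uniq.
have mJ : (m <= #|` J|)%N.
  rewrite Jsize size_filter.
  have := count_predC (fun e => t e w < eps) (trail 0 s).
  rewrite size_trail size_tuple.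
  rewrite (@eq_count _ (predC _) (fun e => eps <= t e w)); last first.
    by move=> e /=; rewrite leNgt.
  have := le_lt_trans (count_le_path_time (trail 0 s) (fun e =>
    t_ge0 e w) eps_gt0) lt.
  rewrite ltr_pM2l// ltr_nat.
  by move: (count _ _) (count _ _) => a b; clear; lia.
have JP : J \in fpowerset [fset e in trail 0 s]%fset.
  by rewrite fpowersetE; apply/fsubsetP => e;
    rewrite !inE mem_filter => /andP[].
have wJ : all_small J w by move=> e /=; rewrite !inE mem_filter => /andP[].
apply: (@le_trans _ _ (\sum_(J <- fpowerset [fset e in trail 0 s]%fset |
    (m <= #|` J|)%N) \1_(all_small J) w)).
  apply: (le_trans _ (ler_term_sum (F := fun J =>
    \1_(all_small J) w) _ JP mJ)) => //.
  by rewrite indicE mem_set.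
apply: (ler_term_sum (I := (m + m).-tuple (direction d))
  (F := fun s => \sum_(J <- fpowerset [fset e in trail 0 s]%fset |
    (m <= #|` J|)%N) \1_(all_small J) w)) => //.
  by move=> s'; apply: sumr_ge0.
exact: mem_index_enum.
Qed.

Lemma expect_cheap m : (expect P (cheap m) <= (2^-1 ^+ m)%:E)%E.
Proof.
have mI J : measurable_fun setT (\1_(all_small J) : Omega -> R).
  by apply: measurable_indic; exact: all_small_measurable.
have inner s : measurable_fun setT (fun w =>
  \sum_(J <- fpowerset [fset e in trail 0 s]%fset |
    (m <= #|` J|)%N) (\1_(all_small J) w : R)).
  under eq_fun do rewrite big_mkcond.
  by apply: measurable_sum => J; case: (m <= #|` J|)%N.
rewrite /cheap; under expect_eq do rewrite big_mkcond.
rewrite expect_sum; last 2 first.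
- by move=> s; case: (uniq (trail 0 s)).
- by move=> s w; case: ifP => // _; exact: sumr_ge0.
have bound (s : (m + m).-tuple (direction d)) : (expect P (fun w =>
  if uniq (trail 0 s) then
      \sum_(J <- fpowerset [fset e in trail 0 s]%fset | (m <= #|` J|)%N)
         \1_(all_small J) w else 0)%R <= (2 ^+ (m + m) * delta ^+ m)%:E)%E.
  have [us|_] := boolP (uniq (trail 0 s)); last first.
    by rewrite expect_cst lee_fin mulr_ge0// ?exprn_ge0// delta_ge0.
  under expect_eq do rewrite big_mkcond.
  rewrite expect_sum; last 2 first.
  + by move=> J; case: (m <= #|` J|)%N.
  + by move=> J w; case: ifP.
  apply: (@le_trans _ _ (\sum_(J <- fpowerset [fset e in trail 0%R s]%fset)
    (delta ^+ m)%:E)%E).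
    apply: lee_sum => J _; have [mJ|_] := boolP (m <= #|` J|)%N;
      last by rewrite expect_cst lee_fin exprn_ge0// delta_ge0.
    rewrite expect_indic; [exact: all_small_prob|exact: all_small_measurable].
  rewrite sumEFin lee_fin big_const_seq count_predT iter_addr_0
    -[leLHS]mulr_natl.
  rewrite ler_wpM2r// ?exprn_ge0 ?delta_ge0//.
  by rewrite card_fpowerset card_fseq undup_id// size_trail size_tuple natrX.
apply: (le_trans (lee_sum _ (fun s _ => bound s))).
rewrite sumEFin lee_fin sumr_const card_tuple card_prod card_ord card_bool.
rewrite -[leLHS]mulr_natl natrX natrM !exprD -!exprMn.
rewrite (_ : d%:R * 2 * (d%:R * 2) * (2 * 2 * delta) = 2^-1)//.
by rewrite /delta; field; rewrite pnatr_eq0 -lt0n.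
Qed.

End CheapTrails.

(** * Restricting to paths of bounded size *)

Section Truncation.
Context (R : realType) (disp : measure_display) (Omega : measurableType disp)
  (P : probability Omega R) (d : nat) (d_gt0 : (0 < d)%N)
  (t : edge d -> {RV P >-> R}).
Hypothesis t_ge0 : forall e w, 0 <= t e w.
Hypothesis t_indep : mutually_independent t.
Context (K : R) (K_ge0 : 0 <= K).
Hypothesis t_moment4 : forall e, (expect P (fun w => t e w ^+ 4)%R <= K%:E)%E.
Context (eps : R) (eps_gt0 : 0 < eps).
Hypothesis t_small : forall e,
  (P [set w | (t e w < eps)%R] <= ((32 * d%:R ^+ 2)^-1)%R%:E)%E.

Let tau (w : Omega) : edge d -> R := fun e => t e w.
Let tau_ge0 w e : 0 <= tau w e. Proof. exact: t_ge0. Qed.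

Lemma path_time_measurable hs : measurable_fun setT (fun w =>
  path_time (tau w) hs).
Proof. by apply: measurable_sum => e; exact: t_measurable. Qed.

Lemma expect_path_time_sqr (hs : seq (edge d)) :
  (expect P (fun w => path_time (tau w) hs ^+ 2)%R <=
   ((size hs)%:R ^+ 2 * (2 + 2 * K))%R%:E)%E.
Proof.
have mX e k : measurable_fun setT (fun w => t e w ^+ k).
  by apply: measurable_funX; exact: t_measurable.
apply: (@le_trans _ _ (expect P (fun w => (size hs)%:R * \sum_(e <- hs) (1 +
  t e w ^+ 2) ^+ 2)%R)).
  apply: expect_le.
  - by apply: measurable_funX; exact: path_time_measurable.
  - apply: measurable_funM => //; apply: measurable_sum => e.
    by apply: measurable_funX; apply: measurable_funD.
  - by move=> w; exact: sqr_ge0.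
  - move=> w; apply: (le_trans (sqr_sum_le _ _)); rewrite ler_wpM2l//.
    apply: ler_sum => e _; have s0 := sqr_ge0 (t e w : R).
    apply: (@le_trans _ _ (1 + t e w ^+ 2)); first by rewrite lerDr.
    by rewrite ler_eXnr// lerDl.
rewrite expect_scale//; last 2 first.
- by apply: measurable_sum => e; apply: measurable_funX; apply: measurable_funD.
- by move=> w; apply: sumr_ge0 => e _; exact: sqr_ge0.
rewrite expect_sum; last 2 first.
- by move=> e; apply: measurable_funX; apply: measurable_funD.
- by move=> e w; exact: sqr_ge0.
rewrite [leRHS](_ : _ = (size hs)%:R%R%:E * ((size hs)%:R * (2 +
  2 * K))%R%:E)%E; last first.
  by rewrite -EFinM mulrA -expr2.
apply: lee_wpmul2l; first by rewrite lee_fin.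
rewrite -sum_const_seq -sumEFin.
by apply: lee_sum => e _; exact: moment_sqr.
Qed.

Lemma expect_path_time_pow4 (hs : seq (edge d)) :
  (expect P (fun w => path_time (tau w) hs ^+ 4)%R <=
   ((size hs)%:R ^+ 4 * K)%R%:E)%E.
Proof.
have mX e k : measurable_fun setT (fun w => t e w ^+ k).
  by apply: measurable_funX; exact: t_measurable.
apply: (@le_trans _ _ (expect P (fun w => (size hs)%:R ^+ 3 *
  \sum_(e <- hs) t e w ^+ 4)%R)).
  apply: expect_le.
  - by apply: measurable_funX; exact: path_time_measurable.
  - by apply: measurable_funM => //; apply: measurable_sum.
  - by move=> w; rewrite exprn_even_ge0.
  - move=> w; rewrite (exprM _ 2 2).
    have s1 : path_time (tau w) hs ^+ 2 <= (size hs)%:R *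
      \sum_(e <- hs) t e w ^+ 2.
      exact: sqr_sum_le.
    apply: (@le_trans _ _ (((size hs)%:R * \sum_(e <- hs) t e w ^+ 2) ^+ 2)).
      by rewrite ler_sqr// nnegrE ?sqr_ge0// (le_trans _ s1)// sqr_ge0.
    rewrite exprMn (exprSr _ 2) -mulrA ler_wpM2l ?sqr_ge0//.
    apply: (le_trans (sqr_sum_le _ _)); rewrite ler_wpM2l//.
    by apply: ler_sum => e _; rewrite -exprM.
rewrite expect_scale//; last 2 first.
- exact: measurable_sum.
- by move=> w; apply: sumr_ge0 => e _; rewrite exprn_even_ge0.
rewrite expect_sum//; last by move=> e w; rewrite exprn_even_ge0.
rewrite [leRHS](_ : _ = ((size hs)%:R ^+ 3)%R%:E * ((size hs)%:R * K)%R%:E)%E;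
  last first.
  by rewrite -EFinM mulrA -exprSr.
apply: lee_wpmul2l; first by rewrite lee_fin exprn_ge0.
rewrite -sum_const_seq -sumEFin.
by apply: lee_sum => e _; exact: t_moment4.
Qed.

Lemma passage_measurable n : measurable_fun setT (fun w =>
  passage_time (tau w) n).
Proof.
apply: (@measurable_fun_cvg _ _ _ _ (fun M w => min_time (tau w) n (n + M)%N)).
- by move=> M; apply: min_time_measurable; exact: leq_addr.
- by move=> w _; exact: min_time_cvg.
Qed.

(** If the restriction to [2 m] edges matters, then the time [S] of the straight
    path is at least that of some trail of [2 m] edges. Either [S] is at least
    [eps * m], and [S ^+ 2 <= S ^+ 4 / (eps * m) ^+ 2], or the trail is cheap,
    and [S ^+ 2 <= S ^+ 4 / lam + lam]; the parameter [lam] balances the fourth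
    moment of [S] against the probability of a cheap trail. *)
Lemma truncation_pointwise n m lam w : (n <= m + m)%N -> (0 < m)%N -> 0 < lam ->
  (min_time (tau w) n (m + m) - passage_time (tau w) n) ^+ 2 <=
  (lam^-1 + (eps * m%:R) ^- 2) * axis_time d_gt0 (tau w) 0 n ^+ 4
    + lam * cheap t eps m w.
Proof.
move=> nM m0 lam0; set S := axis_time _ _ _ _.
have a0 : 0 < eps * m%:R by rewrite mulr_gt0// ltr0n.
have il0 : 0 < lam^-1 by rewrite invr_gt0.
have ia0 : 0 < (eps * m%:R) ^- 2 by rewrite invr_gt0 exprn_gt0.
have S4 : 0 <= S ^+ 4 by rewrite exprn_even_ge0.
have c0 := cheap_ge0 t eps m w.
have Tle := passage_le_min_time d_gt0 (tau_ge0 w) nM.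
have [lt|ge] := ltP (passage_time (tau w) n) (min_time (tau w) n (m + m));
  last first.
  have -> : min_time (tau w) n (m + m) - passage_time (tau w) n = 0.
    by apply/eqP; rewrite subr_eq0 eq_le ge Tle.
  by rewrite expr0n addr_ge0// mulr_ge0// ltW// addr_gt0.
have [s [us les]] := long_cheap_trail d_gt0 (tau_ge0 w) nM lt.
have S0 : 0 <= S by apply: le_trans les; exact: path_time_ge0.
apply: (@le_trans _ _ (S ^+ 2)).
  have := min_time_le_axis d_gt0 (tau_ge0 w) nM; rewrite -/S => leS.
  have := passage_time_ge0 d_gt0 (tau_ge0 w) n => T0.
  by rewrite ler_sqr ?nnegrE ?subr_ge0//; lra.
have [Slt|Sge] := ltP S (eps * m%:R).
  have c1 : 1 <= cheap t eps m w.
    apply: (cheap_ge1 t_ge0 eps_gt0 us).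
    exact: le_lt_trans Slt.
  apply: (@le_trans _ _ (lam^-1 * S ^+ 4 + lam)).
    have : 0 <= (S ^+ 2 - lam) ^+ 2 / lam by rewrite divr_ge0 ?sqr_ge0// ltW.
    have -> : (S ^+ 2 - lam) ^+ 2 / lam = lam^-1 * S ^+ 4 + lam - 2 * S ^+ 2.
      by field; rewrite gt_eqF.
    by have := sqr_ge0 S; lra.
  apply: lerD; first by rewrite ler_wpM2r// lerDl ltW.
  by rewrite ler_peMr// ltW.
apply: (@le_trans _ _ ((eps * m%:R) ^- 2 * S ^+ 4)).
  rewrite mulrC ler_pdivlMr ?exprn_gt0// (exprD _ 2 2) ler_wpM2l ?sqr_ge0//.
  by rewrite ler_sqr ?nnegrE// ltW.
rewrite mulrDl -addrA [leRHS]addrCA lerDl addr_ge0// mulr_ge0// ltW//.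
Qed.

Lemma truncation_error n m lam : (n <= m + m)%N -> (0 < m)%N -> 0 < lam ->
  (expect P (fun w => (min_time (tau w) n (m +
    m) - passage_time (tau w) n) ^+ 2)%R <=
   ((lam^-1 + (eps * m%:R) ^- 2) * (n%:R ^+ 4 * K) + lam * 2^-1 ^+ m)%R%:E)%E.
Proof.
move=> nM m0 lam0.
have mS : measurable_fun setT (fun w => axis_time d_gt0 (tau w) 0 n ^+ 4).
  by apply: measurable_funX; exact: path_time_measurable.
have mC := @cheap_measurable _ _ _ P d t eps m.
have c0 : 0 <= lam^-1 + (eps * m%:R) ^- 2.
  by rewrite addr_ge0// invr_ge0 ?sqr_ge0// ltW.
apply: (@le_trans _ _ (expect P (fun w => (lam^-1 + (eps * m%:R) ^- 2) *
    axis_time d_gt0 (tau w) 0 n ^+ 4 + lam * cheap t eps m w)%R)).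
  apply: expect_le.
  - apply: measurable_funX; apply: measurable_funB.
      exact: min_time_measurable.
    exact: passage_measurable.
  - by apply: measurable_funD; exact: measurable_funM.
  - by move=> w; exact: sqr_ge0.
  - by move=> w; exact: truncation_pointwise.
rewrite expect_add; last 4 first.
- exact: measurable_funM.
- exact: measurable_funM.
- by move=> w; rewrite mulr_ge0// exprn_even_ge0.
- by move=> w; rewrite mulr_ge0 ?cheap_ge0// ltW.
rewrite !expect_scale//; last 3 first.
- by move=> w; rewrite exprn_even_ge0.
- by move=> w; exact: cheap_ge0.
- exact: ltW.
rewrite [leRHS]EFinD; apply: leeD.
  rewrite [leRHS]EFinM; apply: lee_wpmul2l; first by rewrite lee_fin.
  by have := expect_path_time_pow4 (axis_segment d_gt0 0 n);
    rewrite size_axis_segment.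
rewrite [leRHS]EFinM; apply: lee_wpmul2l; first by rewrite lee_fin ltW.
exact: expect_cheap.
Qed.

End Truncation.

(** * Square integrable functions *)

Section SquareIntegrable.
Context (R : realType) (disp : measure_display) (Omega : measurableType disp)
  (P : probability Omega R).
Implicit Types f : Omega -> R.

Lemma Lnorm2E f : ('N[P]_2%:E[EFin \o f] = expect P (fun w =>
  f w ^+ 2)%R `^ 2^-1)%E.
Proof.
rewrite unlock; congr (_ `^ _)%E; apply: eq_integral => w _ /=.
by rewrite powR_mulrn// real_normK// num_real.
Qed.

Lemma square_integrable_Lfun f : measurable_fun setT f ->
  (expect P (fun w => f w ^+ 2)%R < +oo)%E -> f \in Lfun P 2%:E.
Proof.
move=> mf ff; rewrite inE; apply/andP; split; first by rewrite inE.
by rewrite inE/= /finite_norm Lnorm2E; exact: poweR_lty.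
Qed.

(** Nonnegativity of the variance of [f - c]. *)
Lemma mean_dist f c : f \in Lfun P 2%:E ->
  (((fine 'E_P[f] - c) ^+ 2)%R%:E <= expect P (fun w => (f w - c) ^+ 2)%R)%E.
Proof.
move=> f2.
have P1 : P setT \is a fin_num by rewrite fin_num_measure.
have f1 : f \in Lfun P 1 by exact: (Lfun_subset12 P1).
have g2 : (f \- cst c)%R \in Lfun P 2%:E.
  by rewrite rpredB ?lee1n//= => _; rewrite Lfun_cst.
have := variance_ge0 P (f \- cst c)%R.
rewrite varianceE// expectationB//; last exact: Lfun_cst.
rewrite expectation_cst -(fineK (expectation_fin_num f1)) -EFinB -EFin_expe.
rewrite sube_ge0// => h; apply: (le_trans h).
by rewrite unlock.
Qed.

End SquareIntegrable.

(** * Convergence along blocks of integers *)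

Lemma fourth_root n : exists k, (k ^ 4 <= n < k.+1 ^ 4)%N.
Proof.
have ex : exists k, (n < k.+1 ^ 4)%N.
  by exists n; apply: (@leq_trans n.+1); rewrite // -{1}(expn1 n.+1) leq_pexp2l.
case: (ex_minnP ex) => k nk kmin; exists k; rewrite nk andbT.
case: k nk kmin => [//|k _ kmin]; rewrite leqNgt; apply/negP => nk.
by have := kmin k nk; rewrite ltnn.
Qed.

Section BlockConvergence.
Context (R : realType) (disp : measure_display) (Omega : measurableType disp)
  (P : probability Omega R) (X W : nat -> Omega -> R) (C : R).
Hypothesis mX : forall n, measurable_fun setT (X n).
Hypothesis mW : forall k, measurable_fun setT (W k).
Hypothesis W_ge0 : forall k w, 0 <= W k w.
Hypothesis EW : forall k, (0 < k)%N -> (expect P (W k) <= (C / k%:R ^+ 2)%:E)%E.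
Hypothesis X0 : forall w, X 0%N w = 0.
Hypothesis XW : forall k n w, (0 < k)%N -> (k ^ 4 <= n < k.+1 ^ 4)%N ->
  X n w ^+ 2 <= W k w.

Let C_ge0 : 0 <= C.
Proof.
have := le_trans (expect_ge0 P (W_ge0 1)) (EW (ltn0Sn 0)).
by rewrite lee_fin expr1n divr1.
Qed.

(** Telescoping: [1 / (a + 1) ^+ 2] is at most [1 / a - 1 / (a + 1)]. *)
Lemma inv_sqr_sum N : \sum_(0 <= k < N) (C / k.+1%:R ^+ 2) <= 2 * C.
Proof.
have C0 := C_ge0.
have key n : \sum_(0 <= k < n.+1) (C / k.+1%:R ^+ 2) <= 2 * C - C / n.+1%:R.
  elim: n => [|n IH]; first by rewrite big_nat1 expr1n divr1; lra.
  rewrite big_nat_recr//=; apply: (le_trans (lerD IH (lexx _))).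
  rewrite -subr_ge0 -[n.+2%:R]natr1; have : (0 : R) < n.+1%:R by rewrite ltr0n.
  move: (n.+1%:R : R) => a a0.
  have -> : 2 * C - C / (a + 1) - (2 * C - C / a + C / (a + 1) ^+ 2) =
    C / (a * (a + 1) ^+ 2) by field; rewrite !gt_eqF// ltr_wpDr.
  by rewrite divr_ge0// mulr_ge0 ?sqr_ge0// ltW.
case: N => [|N]; first by rewrite big_nil mulr_ge0.
by apply: (le_trans (key N)); rewrite gerBl divr_ge0.
Qed.

Lemma W_series_ae :
  {ae P, forall w, (\sum_(0 <= k <oo) (W k.+1 w)%:E < +oo)%E}.
Proof.
have mE k : measurable_fun setT (fun w =>
  (W k.+1 w)%:E) by exact/measurable_EFinP.
pose F w := (\sum_(0 <= k <oo) (W k.+1 w)%:E)%E.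
have F0 w : (0 <= F w)%E by apply: nneseries_ge0 => k _ _; rewrite lee_fin.
have mF : measurable_fun setT F.
  apply: (@ge0_emeasurable_sum _ _ _ _ (fun k w => (W k.+1 w)%:E) xpredT) => //.
  by move=> k w _ _; rewrite lee_fin.
have iF : P.-integrable setT F.
  apply/integrableP; split=> //.
  under eq_integral do rewrite gee0_abs//.
  rewrite /F integral_nneseries//; last by move=> k w _; rewrite lee_fin.
  apply: (@le_lt_trans _ _ (2 * C)%:E); last by rewrite ltry.
  apply: lime_le; first by apply: is_cvg_nneseries => k _ _; exact: expect_ge0.
  apply: nearW => N.
  apply: (@le_trans _ _ (\sum_(0 <= k < N) (C / k.+1%:R ^+ 2)%:E)%E).
    by apply: lee_sum => k _; exact: EW.
  by rewrite sumEFin lee_fin inv_sqr_sum.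
have := integrable_ae measurableT iF.
apply: filterS => w /(_ I) Ffin.
by rewrite -/(F w) ltey_eq Ffin.
Qed.

Lemma summable_cvg0 (u : nat -> R) : (forall k, 0 <= u k) ->
  (\sum_(0 <= k <oo) (u k)%:E < +oo)%E -> u k @[k --> \oo] --> 0.
Proof.
move=> u0 fin; apply: cvg_series_cvg_0; apply: nondecreasing_is_cvgn.
  by apply/nondecreasing_seqP => k; rewrite /series /= big_nat_recr//= lerDl.
have S0 : (0 <= \sum_(0 <= k <oo) (u k)%:E)%E.
  by apply: nneseries_ge0 => k _ _; rewrite lee_fin.
exists (fine (\sum_(0 <= k <oo) (u k)%:E)%E) => _ [n _ <-].
rewrite -lee_fin fineK ?ge0_fin_numE// /series /= -sumEFin.
by apply: nneseries_lim_ge => k _; rewrite lee_fin.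
Qed.

Lemma block_large K n k : (K ^ 4 <= n)%N -> (k ^ 4 <= n < k.+1 ^ 4)%N ->
  (K <= k)%N.
Proof.
move=> Kn /andP[_ nk]; rewrite leqNgt; apply/negP => kK.
have kK4 : (k.+1 ^ 4 <= K ^ 4)%N by rewrite leq_exp2r.
by have := leq_trans nk (leq_trans kK4 Kn); rewrite ltnn.
Qed.

(** The dominating functions [W k] have a summable series of expectations, so
    their sum is almost surely finite and [W k] tends to 0. *)
Lemma block_cvg_ae : cvg_almost_surely P X (fun=> 0).
Proof.
have := W_series_ae; apply: filterS => w /summable_cvg0.
move=> /(_ (fun k => W_ge0 _ _))/cvgrPdist_lt W0.
apply/cvgrPdist_lt => e e0.
have [K _ WK] := W0 (e ^+ 2) (exprn_gt0 2 e0).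
exists (K.+1 ^ 4)%N => // n /= Kn; rewrite sub0r normrN.
have [k kn] := fourth_root n.
have Kk := block_large Kn kn.
case: k kn Kk => // k kn; rewrite ltnS => Kk.
have := WK k Kk; rewrite sub0r normrN ger0_norm// => Wlt.
rewrite -ltr_sqr ?nnegrE// ?(ltW e0)// real_normK ?num_real//.
exact: le_lt_trans (XW w (ltn0Sn k) kn) Wlt.
Qed.

Lemma X_sqr_le k n : (0 < k)%N -> (k ^ 4 <= n < k.+1 ^ 4)%N ->
  (expect P (fun w => X n w ^+ 2)%R <= (C / k%:R ^+ 2)%:E)%E.
Proof.
move=> k0 kn; apply: le_trans (EW k0); apply: expect_le => //.
- exact: measurable_funX.
- by move=> w; exact: sqr_ge0.
- by move=> w; exact: XW.
Qed.

Lemma X_Lfun n : X n \in Lfun P 2%:E.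
Proof.
apply: square_integrable_Lfun => //.
have [[|k] kn] := fourth_root n.
  have -> : n = 0%N by move: kn; case: n => //.
  rewrite (expect_eq _ (g := fun=> 0)) ?expect_cst ?ltry// => w.
  by rewrite X0 expr0n.
by apply: (le_lt_trans (X_sqr_le (ltn0Sn k) kn)); rewrite ltry.
Qed.

Lemma block_cvg_L2 : cvg_in_L2 P X (fun=> 0).
Proof.
split; [exact: X_Lfun|exact: Lfun_cst|].
have sqr_fin n : expect P (fun w => X n w ^+ 2)%R \is a fin_num.
  apply: integrable_fin_num => //; exact: Lfun2_integrable_sqr (X_Lfun n).
have sqr_ge0' n : 0 <= fine (expect P (fun w => X n w ^+ 2)).
  by rewrite fine_ge0// expect_ge0// => w; exact: sqr_ge0.
have LE n : Lnorm P 2%:E (fun w => (X n w - 0)%:E) =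
    (Num.sqrt (fine (expect P (fun w => X n w ^+ 2)%R)))%:E.
  rewrite (_ : (fun w => (X n w - 0)%:E) = EFin \o X n); last first.
    by apply/funext => w; rewrite subr0.
  by rewrite Lnorm2E -{1}(fineK (sqr_fin n)) poweR12_sqrt// lee_fin.
rewrite [X in X @ _](_ : _ = fun n => (Num.sqrt (fine (expect P (fun w =>
  X n w ^+ 2)%R)))%:E); last first.
  by apply/funext => n; exact: LE.
apply: cvg_EFin; first exact: nearW.
apply/cvgrPdist_lt => e e0.
pose K := Num.truncn (C / e ^+ 2).
exists (K.+1 ^ 4)%N => // n /= Kn; rewrite sub0r normrN ger0_norm ?sqrtr_ge0//.
have [k kn] := fourth_root n.
have Kk := block_large Kn kn.
have k0 : (0 < k)%N by exact: leq_ltn_trans Kk.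
rewrite -(ger0_norm (ltW e0)) -sqrtr_sqr ltr_sqrt ?exprn_gt0//.
have : fine (expect P (fun w => X n w ^+ 2)%R) <= C / k%:R ^+ 2.
  by rewrite -lee_fin fineK//; exact: X_sqr_le.
move=> /le_lt_trans; apply.
have kR : (0 : R) < k%:R by rewrite ltr0n.
rewrite ltr_pdivrMr ?exprn_gt0// mulrC -ltr_pdivrMr ?exprn_gt0//.
apply: (lt_le_trans (truncnS_gt _)).
apply: (@le_trans _ _ k%:R); first by rewrite ler_nat.
by rewrite ler_eXnr// ler1n.
Qed.

End BlockConvergence.

(** * Concentration of the passage time *)

Section BlockEstimates.
Context (R : realType) (disp : measure_display) (Omega : measurableType disp)
  (P : probability Omega R) (d : nat) (d_gt0 : (0 < d)%N)
  (t : edge d -> {RV P >-> R}).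
Hypothesis t_ge0 : forall e w, 0 <= t e w.
Hypothesis t_indep : mutually_independent t.
Context (K : R) (K_ge0 : 0 <= K).
Hypothesis t_moment4 : forall e, (expect P (fun w => t e w ^+ 4)%R <= K%:E)%E.
Context (eps : R) (eps_gt0 : 0 < eps).
Hypothesis t_small : forall e,
  (P [set w | (t e w < eps)%R] <= ((32 * d%:R ^+ 2)^-1)%R%:E)%E.

Let T n w := passage_time (fun e => t e w) n.
Let mT n : measurable_fun setT (T n).
Proof. exact: passage_measurable. Qed.

Lemma passage_Lfun n : T n \in Lfun P 2%:E.
Proof.
apply: square_integrable_Lfun => //.
apply: (@le_lt_trans _ _ (expect P (fun w =>
    axis_time d_gt0 (fun e => t e w) 0 n ^+ 2)%R)).
  apply: expect_le.
  - exact: measurable_funX.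
  - by apply: measurable_funX; exact: path_time_measurable.
  - by move=> w; exact: sqr_ge0.
  - move=> w; have t0 e := t_ge0 e w.
    have [hs [p _ le]] := axis_time_path d_gt0 t0 n.
    have T0 := passage_time_ge0 d_gt0 t0 n.
    have Tle := le_trans (passage_time_le d_gt0 t0 p) le.
    by rewrite ler_sqr ?nnegrE// (le_trans T0).
by apply: (le_lt_trans (expect_path_time_sqr t_ge0 t_moment4 _)); rewrite ltry.
Qed.

Lemma half_pow_le m : (0 < m)%N -> 2^-1 ^+ m <= m%:R^-1 :> R.
Proof.
move=> m0; rewrite exprVn lef_pV2 ?posrE ?exprn_gt0 ?ltr0n//.
by rewrite -natrX ler_nat ltnW// ltn_expl.
Qed.

Lemma block_truncation k : (0 < k)%N ->
  ((k%:R ^+ 12)^-1 + (eps * (k ^ 6)%:R) ^- 2) * ((k ^ 4)%:R ^+ 4 * K)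
    + k%:R ^+ 12 * 2^-1 ^+ (k ^ 6)
  <= ((1 + eps ^- 2) * K + 1) * k%:R ^+ 6.
Proof.
move=> k0; have x0 : (0 : R) < k%:R by rewrite ltr0n.
have x1 : (1 : R) <= k%:R by rewrite ler1n.
have k6 : (0 < k ^ 6)%N by rewrite expn_gt0 k0.
have h := half_pow_le k6; rewrite natrX in h.
have h' : k%:R ^+ 12 * 2^-1 ^+ (k ^ 6) <= k%:R ^+ 6 :> R.
  apply: (le_trans (ler_wpM2l _ h)); first by rewrite exprn_ge0// ltW.
  by rewrite (exprD _ 6 6) mulfK// expf_neq0// gt_eqF.
rewrite [leRHS]mulrDl mul1r; apply: lerD => //.
rewrite !natrX; set x : R := k%:R in x0 x1 *.
have -> : ((x ^+ 12)^-1 + (eps * x ^+ 6) ^- 2) * ((x ^+ 4) ^+ 4 * K) =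
    (1 + eps ^- 2) * K * x ^+ 4 by field; rewrite !gt_eqF.
rewrite ler_wpM2l//; last by rewrite ler_weXn2l.
by rewrite mulr_ge0// addr_ge0// invr_ge0 sqr_ge0.
Qed.

Definition block_const : R :=
  2 * ((1 + eps ^- 2) * K + 1) + 12 * (2 + 2 * K).

(** At distance [k ^ 4], paths are restricted to [2 * k ^ 6] edges and [lam] is
    [k ^ 12]: the variance of the restricted minimum and the error of the
    restriction are then both of order at most [k ^ 6], negligible compared to
    the squared distance [k ^ 8] by the summable factor [1 / k ^ 2]. *)
Lemma block_variance k : (0 < k)%N -> exists c : R,
  (expect P (fun w => (T (k ^ 4) w - c) ^+ 2)%R <=
    (block_const * k%:R ^+ 6)%R%:E)%E.
Proof.
move=> k0; have k6 : (0 < k ^ 6)%N by rewrite expn_gt0 k0.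
have le46 : (k ^ 4 <= k ^ 6 + k ^ 6)%N.
  by rewrite (leq_trans _ (leq_addr _ _))// leq_pexp2l.
have [c cP] := min_time_variance d_gt0 t_ge0 t_indep K_ge0 t_moment4 le46.
have lam0 : (0 : R) < k%:R ^+ 12 by rewrite exprn_gt0// ltr0n.
have tr := truncation_error d_gt0 t_ge0 t_indep t_moment4 eps_gt0 t_small le46
  k6 lam0.
exists c; set Tm := fun w => min_time (fun e => t e w) (k ^ 4) (k ^ 6 + k ^ 6).
have mTm : measurable_fun setT Tm by exact: min_time_measurable.
apply: (@le_trans _ _ (expect P (fun w =>
  2 * (Tm w - T (k ^ 4) w) ^+ 2 + 2 * (Tm w - c) ^+ 2)%R)).
  apply: expect_le.
  - by apply: measurable_funX; apply: measurable_funB.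
  - by apply: measurable_funD; apply: measurable_funM => //;
      apply: measurable_funX; apply: measurable_funB.
  - by move=> w; exact: sqr_ge0.
  - move=> w; rewrite -[X in 2 * X + _]sqrrN opprB.
    by apply: le_trans (sqr_add_le _ _); rewrite subrKA.
have mA : measurable_fun setT (fun w => (Tm w - T (k ^ 4) w) ^+ 2).
  by apply: measurable_funX; apply: measurable_funB.
have mB : measurable_fun setT (fun w => (Tm w - c) ^+ 2).
  by apply: measurable_funX; apply: measurable_funB.
rewrite expect_add; last 4 first.
- exact: measurable_funM.
- exact: measurable_funM.
- by move=> w; rewrite mulr_ge0// sqr_ge0.
- by move=> w; rewrite mulr_ge0// sqr_ge0.
rewrite !expect_scale//; last 2 first.
- by move=> w; exact: sqr_ge0.
- by move=> w; exact: sqr_ge0.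
rewrite [leRHS](_ : _ = 2%:E * (((1 + eps ^- 2) * K + 1) * k%:R ^+ 6)%R%:E +
    2%:E * (6 * k%:R ^+ 6 * (2 + 2 * K))%R%:E)%E; last first.
  by rewrite -!EFinM -EFinD; congr EFin; rewrite /block_const; ring.
apply: leeD; apply: lee_wpmul2l => //.
  by apply: (le_trans tr); rewrite lee_fin; exact: block_truncation.
apply: (le_trans cP); rewrite lee_fin ler_wpM2r ?addr_ge0 ?mulr_ge0//.
rewrite natrD natrX.
have : (1 : R) <= k%:R ^+ 6 by rewrite exprn_ege1// ler1n.
by move: (k%:R ^+ 6 : R) => y; lra.
Qed.

Definition block_gap k : nat := (k.+1 ^ 4 - k ^ 4)%N.

Lemma block_gap_le k : (0 < k)%N -> (block_gap k <= 15 * k ^ 3)%N.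
Proof.
move=> k0; rewrite /block_gap leq_subLR.
have h2 : (k ^ 2 <= k ^ 3)%N by rewrite leq_pexp2l.
have h1 : (k ^ 1 <= k ^ 3)%N by rewrite leq_pexp2l.
have h0 : (k ^ 0 <= k ^ 3)%N by rewrite leq_pexp2l.
have -> : (k.+1 ^ 4 = k ^ 4 + 4 * k ^ 3 + 6 * k ^ 2 + 4 * k ^ 1 + k ^ 0)%N.
  by rewrite -addn1; ring.
lia.
Qed.

Definition gap_time k w : R :=
  axis_time d_gt0 (fun e => t e w) (k ^ 4) (block_gap k).

Lemma gap_time_measurable k : measurable_fun setT (gap_time k).
Proof. exact: path_time_measurable. Qed.

(** Within a block the passage time moves by at most the time of the [O(k ^ 3)]
    axis edges of the block, whose second moment is of order [k ^ 6] as well. *)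
Lemma block_interpolation k n w : (k ^ 4 <= n < k.+1 ^ 4)%N ->
  `|T n w - T (k ^ 4) w| <= gap_time k w.
Proof.
move=> /andP[kn nk]; have t0 e := t_ge0 e w.
have := passage_time_lipschitz d_gt0 t0 (k ^ 4) (n - k ^ 4).
rewrite subnKC// => /le_trans; apply; apply: axis_time_mono => //.
by rewrite leq_sub2r// ltnW.
Qed.

Lemma expect_gap_time k : (0 < k)%N ->
  (expect P (fun w => gap_time k w ^+ 2)%R <=
    (225 * (2 + 2 * K) * k%:R ^+ 6)%R%:E)%E.
Proof.
move=> k0; apply: (le_trans (expect_path_time_sqr t_ge0 t_moment4 _)).
rewrite size_axis_segment lee_fin.
have -> : 225 * (2 + 2 * K) * k%:R ^+ 6 = (15 * k ^ 3)%:R ^+ 2 * (2 + 2 * K).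
  by rewrite natrM natrX; ring.
rewrite ler_wpM2r ?addr_ge0 ?mulr_ge0// ler_sqr ?nnegrE//.
by rewrite ler_nat block_gap_le.
Qed.

Definition conv_const : R := 2 * block_const + 450 * (2 + 2 * K).

Let X (n : nat) (w : Omega) : R := n%:R^-1 * (T n w - fine 'E_P[T n]%E).

(** Within a block, [T n] is close to the constant [c k], hence so is its
    expectation; both deviations enter the dominating function [W k]. *)
Lemma passage_time_concentration :
  cvg_almost_surely P X (fun=> 0) /\ cvg_in_L2 P X (fun=> 0).
Proof.
have /choice[c cP] : forall k, exists c, (0 < k)%N ->
    (expect P (fun w => (T (k ^ 4) w - c) ^+ 2)%R <=
      (block_const * k%:R ^+ 6)%R%:E)%E.
  case=> [|k]; first by exists 0.
  by have [c cP] := block_variance (ltn0Sn k); exists c.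
pose V k w := 2 * (T (k ^ 4) w - c k) ^+ 2 + 2 * gap_time k w ^+ 2.
pose W k w := (k%:R ^+ 8)^-1 * (2 * V k w + 2 * (conv_const * k%:R ^+ 6)).
have mA k : measurable_fun setT (fun w => (T (k ^ 4) w - c k) ^+ 2).
  by apply: measurable_funX; apply: measurable_funB.
have mD k : measurable_fun setT (fun w => gap_time k w ^+ 2).
  by apply: measurable_funX; exact: gap_time_measurable.
have mV k : measurable_fun setT (V k).
  by apply: measurable_funD; apply: measurable_funM.
have mW k : measurable_fun setT (W k).
  by apply: measurable_funM => //; apply: measurable_funD => //;
    apply: measurable_funM.
have V0 k w : 0 <= V k w by rewrite addr_ge0// mulr_ge0// sqr_ge0.
have K0 : 0 <= 2 + 2 * K by rewrite addr_ge0// mulr_ge0.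
have cc0 : 0 <= conv_const.
  have E0 : 0 <= eps ^- 2 by rewrite invr_ge0 sqr_ge0.
  by rewrite /conv_const /block_const !(addr_ge0, mulr_ge0).
have W0 k w : 0 <= W k w.
  by rewrite mulr_ge0 ?invr_ge0 ?exprn_ge0// addr_ge0// mulr_ge0// mulr_ge0
    ?exprn_ge0.
have EV k : (0 < k)%N -> (expect P (V k) <= (conv_const * k%:R ^+ 6)%R%:E)%E.
  move=> k0; rewrite /V expect_add; last 4 first.
  - exact: measurable_funM.
  - exact: measurable_funM.
  - by move=> w; rewrite mulr_ge0// sqr_ge0.
  - by move=> w; rewrite mulr_ge0// sqr_ge0.
  rewrite !expect_scale//; last 2 first.
  - by move=> w; exact: sqr_ge0.
  - by move=> w; exact: sqr_ge0.
  rewrite [leRHS](_ : _ = 2%:E * (block_const * k%:R ^+ 6)%R%:E +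
    2%:E * (225 * (2 + 2 * K) * k%:R ^+ 6)%R%:E)%E; last first.
    by rewrite -!EFinM -EFinD; congr EFin; rewrite /conv_const; ring.
  by apply: leeD; apply: lee_wpmul2l => //; [exact: cP|exact: expect_gap_time].
have TV k n w : (k ^ 4 <= n < k.+1 ^ 4)%N -> (T n w - c k) ^+ 2 <= V k w.
  move=> kn; rewrite /V [leRHS]addrC -[T n w - _](subrKA (T (k ^ 4) w)).
  apply: (le_trans (sqr_add_le _ _)); rewrite lerD2r ler_wpM2l//.
  have h := block_interpolation w kn.
  by rewrite -real_normK ?num_real// ler_sqr ?nnegrE// (le_trans _ h).
have mean_close k n : (0 < k)%N -> (k ^ 4 <= n < k.+1 ^ 4)%N ->
    (fine 'E_P[T n]%E - c k) ^+ 2 <= conv_const * k%:R ^+ 6.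
  move=> k0 kn; rewrite -lee_fin; apply: le_trans (EV k k0).
  apply: (le_trans (mean_dist _ (passage_Lfun n))); apply: expect_le => //.
  - by apply: measurable_funX; apply: measurable_funB.
  - by move=> w; exact: sqr_ge0.
  - by move=> w; exact: TV.
have XW k n w : (0 < k)%N -> (k ^ 4 <= n < k.+1 ^ 4)%N -> X n w ^+ 2 <= W k w.
  move=> k0 kn; have /andP[k4n _] := kn.
  have k40 : (0 < k ^ 4)%N by rewrite expn_gt0 k0.
  rewrite /X /W exprMn; apply: ler_pM; [exact: sqr_ge0|exact: sqr_ge0| |].
    rewrite exprVn lef_pV2 ?posrE ?exprn_gt0 ?ltr0n//;
      last exact: leq_trans k4n.
    by rewrite (exprM _ 4 2) -natrX ler_sqr ?nnegrE// ler_nat.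
  have -> : T n w - fine 'E_P[T n]%E = (T n w - c k) + (c k - fine 'E_P[T n]%E).
    by rewrite subrKA.
  apply: (le_trans (sqr_add_le _ _)); apply: lerD; rewrite ler_wpM2l//.
    exact: TV.
  by rewrite -sqrrN opprB; exact: mean_close.
have EW k : (0 < k)%N -> (expect P (W k) <= (4 * conv_const / k%:R ^+ 2)%:E)%E.
  move=> k0; have kR : (0 : R) < k%:R by rewrite ltr0n.
  have c0 : 0 <= 2 * (conv_const * k%:R ^+ 6) by rewrite !mulr_ge0// exprn_ge0.
  have m2V : measurable_fun setT (fun w => 2 * V k w) by exact: measurable_funM.
  have V20 w : 0 <= 2 * V k w by rewrite mulr_ge0.
  have mVc : measurable_fun setT (fun w => 2 * V k w +
    2 * (conv_const * k%:R ^+ 6)).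
    exact: measurable_funD.
  rewrite /W expect_scale//; last by move=> w; rewrite addr_ge0.
  rewrite expect_add//.
  rewrite expect_cst expect_scale//.
  have -> : 4 * conv_const / k%:R ^+ 2 = (k%:R ^+ 8)^-1 *
      (2 * (conv_const * k%:R ^+ 6) + 2 * (conv_const * k%:R ^+ 6)).
    by move: (k%:R : R) kR => x x0; field; rewrite gt_eqF.
  rewrite [leRHS]EFinM; apply: lee_wpmul2l;
    first by rewrite lee_fin invr_ge0 exprn_ge0.
  rewrite [leRHS]EFinD leeD2r// [leRHS]EFinM; apply: lee_wpmul2l => //;
    exact: EV.
have mX n : measurable_fun setT (X n).
  by apply: measurable_funM => //; apply: measurable_funB.
have X0 w : X 0%N w = 0 by rewrite /X invr0 mul0r.
split; [exact: block_cvg_ae mW W0 EW XW|exact: block_cvg_L2 mX mW EW X0 XW].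
Qed.

End BlockEstimates.

Lemma pow4_le_powR (R : realType) (x p : R) : 0 <= x -> 4 <= p ->
  x ^+ 4 <= 1 + x `^ p.
Proof.
move=> x0 p4; have [x1|x1] := leP x 1.
  by apply: (@le_trans _ _ 1); rewrite ?exprn_ile1// lerDl powR_ge0.
rewrite -powR_mulrn// (le_trans (ler_powR (ltW x1) p4))// lerDr//.
Qed.

Theorem theorem1 (R : realType) (disp : measure_display)
    (Omega : measurableType disp) (P : probability Omega R)
    (d : nat) (hd : (2 <= d)%N)
    (t : edge d -> {RV P >-> R})
    (t_ge0 : forall (e : edge d) (w : Omega), 0 <= t e w)
    (t_indep : mutually_independent t)
    (t_small :
      ereal_sup [set P [set w | t e w < eps] | e in [set: edge d]]
        @[eps --> (0 : R)^'+] --> 0%E)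
    (t_moment : exists eta : R, 0 < eta /\
      (ereal_sup [set 'E_P[(fun w => (t e w `^ (6 * (1 + d%:R) + eta))%R)]%E
                 | e in [set: edge d]] < +oo)%E) :
  let passage (n : nat) (w : Omega) : R := passage_time (fun e => t e w) n in
  let X (n : nat) (w : Omega) : R :=
    n%:R^-1 * (passage n w - fine ('E_P[passage n])%E) in
  cvg_almost_surely P X (fun=> 0) /\ cvg_in_L2 P X (fun=> 0).
Proof.
move=> passage X.
have d_gt0 : (0 < d)%N by exact: ltn_trans hd.
have [eta [eta0 moments]] := t_moment.
set p := 6 * (1 + d%:R) + eta in moments.
set B := ereal_sup _ in moments.
have p4 : 4 <= p.
  have d0 : (0 : R) <= d%:R by [].
  by rewrite /p; lra.
have [b b0 Bb] : exists2 b : R, 0 <= b & (B <= b%:E)%E.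
  move: B moments => [b| |]// _; last by exists 0; rewrite ?leNye.
  by exists (Num.max 0 b); rewrite ?lee_fin le_max lexx ?orbT.
have moment4 e : (expect P (fun w => t e w ^+ 4)%R <= (1 + b)%R%:E)%E.
  have mp : measurable_fun setT (fun w => t e w `^ p).
    by apply: (@measurableT_comp _ _ _ _ _ _ (fun x : R => x `^ p)).
  apply: (@le_trans _ _ (expect P (fun w => 1 + t e w `^ p)%R)).
    apply: expect_le.
    - by apply: measurable_funX; exact: t_measurable.
    - exact: measurable_funD.
    - by move=> w; rewrite exprn_ge0.
    - by move=> w; exact: pow4_le_powR.
  rewrite expect_add//; last by move=> w; exact: powR_ge0.
  rewrite expect_cst EFinD leeD2l//; apply: le_trans Bb.
  by apply: ereal_sup_ubound; exists e => //; rewrite unlock.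
have delta0 : (0 : R) < (32 * d%:R ^+ 2)^-1.
  by rewrite invr_gt0 mulr_gt0// exprn_gt0// ltr0n.
have [eps [eps0 small]] : exists eps : R, 0 < eps /\ forall e,
    (P [set w | (t e w < eps)%R] <= ((32 * d%:R ^+ 2)^-1)%R%:E)%E.
  move/fine_cvgP: t_small => [fin /cvgrPdist_lt/(_ _ delta0) lt].
  have [eps [[fin_eps lt_eps] eps0]] := @filter_ex _ _ _ _
    (filterI (filterI fin lt) (nbhs_right_gt (0 : R))).
  exists eps; split=> // e.
  apply: (@le_trans _ _ (ereal_sup [set P [set w | t e w < eps] | e in [set:
    edge d]])).
    by apply: ereal_sup_ubound; exists e.
  rewrite -(fineK fin_eps) lee_fin; apply/ltW/(le_lt_trans _ lt_eps).
  by rewrite sub0r normrN ler_norm.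
exact: (passage_time_concentration d_gt0 t_ge0 t_indep (addr_ge0 ler01 b0)
  moment4 eps0 small).
Qed.
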